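(* Let $(A,\cdot,\{l_k\}_{k=1}^{+\infty})$ be a homotopy Poisson algebra. Then there is a post-Lie$_\infty$ algebra structure on $A\otimes A$ given by $$\begin{aligned} \mathfrak M_{0,1}(a_1\otimes x_1)&=l_1(a_1)\otimes x_1+(-1)^{a_1}a_1\otimes l_1(x_1),\\ \mathfrak M_{0,q}\big((a_1\otimes x_1)\cdots (a_q\otimes x_q)\big)&=(-1)^{\sum_{i=1}^{q}(1+x_1+\cdots+x_{i-1})a_i}\,a_1\cdots a_q\otimes l_q(x_1,\ldots,x_q)\qquad (q\ge2),\\ \mathfrak M_{p,1}\big((a_1\otimes x_1)\cdots (a_p\otimes x_p)\otimes(a_{p+1}\otimes x_{p+1})\big)&=(-1)^{\sum_{i=1}^{p}(1+x_1+\cdots+x_{i-1})a_i}\,a_1\cdots a_p\,l_{p+1}(x_1,\ldots,x_p,a_{p+1})\otimes x_{p+1}\qquad (p\ge1), \end{aligned}$$ and $\mathfrak M_{p,q}=0$ in all other cases.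
   Context: The ground field has characteristic zero; graded means $\mathbb Z$-graded; in exponents of $-1$ a homogeneous element stands for its degree. $\mathsf S(V)$ is the graded symmetric algebra, products in it are written by juxtaposition; $\mathbb S_{(i_1,\dots,i_k)}$ is the set of $(i_1,\dots,i_k)$-shuffles; $\varepsilon(\sigma)$ is the Koszul sign: $v_1\cdots v_n=\varepsilon(\sigma)v_{\sigma(1)}\cdots v_{\sigma(n)}$ in $\mathsf S(V)$. An $L_\infty$-algebra $(\mathfrak g,\{l_k\}_{k\ge1})$ is a graded vector space with graded symmetric maps $l_k:\mathsf S^k(\mathfrak g)\to\mathfrak g$ of degree $1$ such that for all $n\ge1$: $\sum_{i=1}^{n}\sum_{\sigma\in \mathbb S_{(i,n-i)}}\varepsilon(\sigma)l_{n-i+1}(l_i(x_{\sigma(1)},\ldots,x_{\sigma(i)}),x_{\sigma(i+1)},\ldots,x_{\sigma(n)})=0$. A homotopy Poisson algebra is a graded commutative (associative) algebra $(A,\cdot)$ with an $L_\infty$-algebra structure $\{l_k\}_{k\ge1}$ such that, for all $k\ge1$, $l_{k}(x_1,\ldots,x_{k-1},x\cdot y)=l_{k}(x_1,\ldots,x_{k-1},x)\cdot y+(-1)^{x(1+x_1+\cdots+x_{k-1})}x\cdot l_{k}(x_1,\ldots,x_{k-1},y)$. A post-Lie$_\infty$ algebra is a graded vector space $\mathfrak g$ with linear maps $\mathfrak M_{p,q}:\mathsf S^p(\mathfrak g)\otimes \mathsf S^q(\mathfrak g)\to\mathfrak g$ of degree $1$, $p\ge0,q\ge1$, such that for all $n\ge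 0,m\ge1$ and homogeneous $x_1,\dots,x_{n+m}$ $$\begin{aligned}&\sum_{\substack{0\le j\le n-1,\,1\le i\le n\\ i+j\le n}}\ \sum_{\sigma\in \mathbb S_{(j,i,n-j-i)}}\varepsilon(\sigma)\mathfrak M_{n-j-i+1,m}\Big(\mathfrak M_{j,i}(x_{\sigma(1)}\cdots x_{\sigma(j)}\otimes x_{\sigma(j+1)}\cdots x_{\sigma(j+i)})x_{\sigma(j+i+1)}\cdots x_{\sigma(n)}\otimes x_{n+1}\cdots x_{n+m}\Big)\\ &+\sum_{0\le j\le n}\sum_{\sigma\in\mathbb S_{(n-j,j)}}\sum_{1\le i\le m}\sum_{\tau\in\mathbb S_{(i,m-i)}}\varepsilon(\sigma)\varepsilon(\tau)(-1)^{x_{\sigma(1)}+\cdots+x_{\sigma(n-j)}}\\ &\mathfrak M_{n-j,m-i+1}\Big(x_{\sigma(1)} \cdots x_{\sigma(n-j)}\otimes \mathfrak M_{j,i}\big(x_{\sigma(n-j+1)} \cdots x_{\sigma(n)}\otimes x_{n+\tau(1)} \cdots x_{n+\tau(i)}\big) x_{n+\tau(i+1)} \cdots x_{n+\tau(m)}\Big)=0.\end{aligned}$$ *)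

(* Defs.v *)
From HB Require Import structures.
From mathcomp Require Import all_boot all_order all_fingroup all_algebra.
From mathcomp Require Import generic_quotient ring_quotient.
From mathcomp Require Import boolp freeg.

Set Implicit Arguments.
Unset Strict Implicit.
Unset Printing Implicit Defensive.

Import GRing.Theory.
Local Open Scope ring_scope.
Local Open Scope quotient_scope.

(* A direct sum decomposition V = \bigoplus_(i : int) V_i, given by the
   projections hcomp i : V -> V onto the summands; every x is the sum of
   finitely many of its components. *)
HB.mixin Record isGraded (K : fieldType) V of GRing.Lmodule K V := {
  hcomp : int -> V -> V;
  hcomp_is_linear : forall i, linear (hcomp i);
  hcomp_hcomp : forall i j x, hcomp i (hcomp j x) = if i == j then hcomp j x else 0;
  hcomp_sum : forall x, exists s : seq int, uniq s /\ x = \sum_(i <- s) hcomp i x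
}.

#[short(type="gradedType")]
HB.structure Definition Graded (K : fieldType) :=
  {V of isGraded K V & GRing.Lmodule K V}.

HB.instance Definition _ (K : fieldType) (V : gradedType K) (i : int) :=
  GRing.isLinear.Build K V V *:%R (hcomp i : V -> V) (@hcomp_is_linear K V i).

Definition homogeneous (K : fieldType) (V : gradedType K) (i : int) (x : V) : Prop :=
  hcomp i x = x.

Section Support.
Variables (K : fieldType) (V : gradedType K).
Implicit Types (x y : V) (i j : int).

Lemma homogeneous_hcomp i x : homogeneous i (hcomp i x).
Proof. by rewrite /homogeneous hcomp_hcomp eqxx. Qed.

Lemma hcomp_homogeneous i j x :
  homogeneous j x -> hcomp i x = if i == j then x else 0.
Proof. by move=> hx; rewrite -{1}hx hcomp_hcomp hx. Qed.

Definition supports (s : seq int) x := uniq s && (x == \sum_(i <- s) hcomp i x).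

Lemma ex_supports x : exists s, supports s x.
Proof. by have [s [us /eqP hs]] := hcomp_sum x; exists s; rewrite /supports us. Qed.

Definition gsupp x := xchoose (ex_supports x).

Lemma gsupp_uniq x : uniq (gsupp x).
Proof. by case/andP: (xchooseP (ex_supports x)). Qed.

Lemma gsupp_sum x : x = \sum_(i <- gsupp x) hcomp i x.
Proof. by case/andP: (xchooseP (ex_supports x)) => _ /eqP. Qed.

Lemma hcomp_out i (s : seq int) x :
  x = \sum_(j <- s) hcomp j x -> i \notin s -> hcomp i x = 0.
Proof.
move=> -> his; rewrite linear_sum /= big_seq big1 // => j js.
by rewrite hcomp_hcomp; case: eqP his => // ->; rewrite js.
Qed.

Lemma sum_gsupp (U : zmodType) (F : int -> U) x (s : seq int) :
  uniq s -> (forall i, i \notin s -> F i = 0) ->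
  (forall i, hcomp i x = 0 -> F i = 0) ->
  \sum_(i <- gsupp x) F i = \sum_(i <- s) F i.
Proof.
move=> us hs hF.
rewrite (bigID (fun i => i \in s)) /= [X in _ + X]big1 ?addr0; last first.
  by move=> i /hs.
rewrite [RHS](bigID (fun i => i \in gsupp x)) /= [X in _ = _ + X]big1 ?addr0; last first.
  by move=> i hi; apply/hF/(hcomp_out (gsupp_sum x) hi).
rewrite -big_filter -[RHS]big_filter; apply: perm_big.
apply: uniq_perm; rewrite ?filter_uniq ?gsupp_uniq // => i.
by rewrite !mem_filter andbC.
Qed.

End Support.

(* The quotient of the free vector space on A * B by the subspace spanned by
   the bilinearity relations. *)
Section Tensor.
Variables (K : fieldType) (A B : lmodType K).

Local Notation F := {freeg (A * B)%type / K}.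
Local Notation gen a b := (<< (a, b) >> : F).

Inductive bilinear_rel : F -> Prop :=
| bilinear_rel_l c a a' b :
    bilinear_rel (gen (c *: a + a') b - (c *: gen a b + gen a' b))
| bilinear_rel_r c a b b' :
    bilinear_rel (gen a (c *: b + b') - (c *: gen a b + gen a b')).

Inductive tensor_null : F -> Prop :=
| tensor_null0 : tensor_null 0
| tensor_nullD c r z : bilinear_rel r -> tensor_null z -> tensor_null (c *: r + z).

Lemma fgscaleU c k p : c *: (<< k *g p >> : F) = << c * k *g p >>.
Proof. by apply/eqP/freeg_eqP => q; rewrite coeffZ !coeffU mulrA. Qed.

Lemma tensor_nullP k z1 z2 :
  tensor_null z1 -> tensor_null z2 -> tensor_null (k *: z1 + z2).
Proof.
move=> h1 h2; elim: h1 => [|c r z hr _ IH]; first by rewrite scaler0 add0r.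
by rewrite scalerDr scalerA -addrA; apply: tensor_nullD.
Qed.

Lemma tensor_null_rel r : bilinear_rel r -> tensor_null r.
Proof. by move=> /(tensor_nullD 1) /(_ tensor_null0); rewrite scale1r addr0. Qed.

Definition tensor_ker : {pred F} := fun z => `[< tensor_null z >].

Lemma tensor_ker_zmod_closed : zmod_closed tensor_ker.
Proof.
split=> [|x y]; first by apply/asboolP; apply: tensor_null0.
move=> /asboolP hx /asboolP hy; apply/asboolP.
by rewrite addrC -scaleN1r; apply: tensor_nullP.
Qed.

HB.instance Definition _ := GRing.isZmodClosed.Build F tensor_ker tensor_ker_zmod_closed.

Definition tensor := @Quotient.quot F tensor_ker.
HB.instance Definition _ := GRing.Zmodule.on tensor.
HB.instance Definition _ := ZmodQuotient.on tensor.

Definition tensor_scale (c : K) (z : tensor) : tensor := \pi_tensor (c *: repr z).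

Lemma tensor_eqP (x y : F) : reflect (\pi_tensor x = \pi_tensor y) `[< tensor_null (x - y) >].
Proof.
apply: (iffP idP) => [h|/eqP]; first by apply/eqP; rewrite -Quotient.idealrBE.
by rewrite -Quotient.idealrBE.
Qed.

Lemma pi_tensor_scale c (x : F) : tensor_scale c (\pi_tensor x) = \pi_tensor (c *: x).
Proof.
rewrite /tensor_scale; apply/tensor_eqP/asboolP.
have /tensor_eqP/asboolP h : \pi_tensor (repr (\pi_tensor x)) = \pi_tensor x by rewrite reprK.
by rewrite -scalerBr -[_ *: _]addr0; apply: tensor_nullP h tensor_null0.
Qed.

Lemma tensor_scaleA a b (v : tensor) :
  tensor_scale a (tensor_scale b v) = tensor_scale (a * b) v.
Proof. by rewrite -[v]reprK (pi_tensor_scale b) !pi_tensor_scale scalerA. Qed.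

Lemma tensor_scale1 : left_id 1 tensor_scale.
Proof. by move=> v; rewrite -[v]reprK pi_tensor_scale scale1r. Qed.

Lemma tensor_scaleDr : right_distributive tensor_scale +%R.
Proof.
move=> c u v; rewrite -[u]reprK -[v]reprK -raddfD /= !pi_tensor_scale.
by rewrite scalerDr raddfD.
Qed.

Lemma tensor_scaleDl v : {morph tensor_scale^~ v : a b / a + b}.
Proof.
by move=> a b; rewrite -[v]reprK !pi_tensor_scale scalerDl raddfD.
Qed.

HB.instance Definition _ := GRing.Zmodule_isLmodule.Build K tensor
  tensor_scaleA tensor_scale1 tensor_scaleDr tensor_scaleDl.

Definition tens (a : A) (b : B) : tensor := \pi_tensor (gen a b).

Lemma pi_tensorZ c (x : F) : \pi_tensor (c *: x) = c *: \pi_tensor x.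
Proof. by rewrite -pi_tensor_scale. Qed.

Lemma pi_tensorP c (x y : F) :
  \pi_tensor (c *: x + y) = c *: \pi_tensor x + \pi_tensor y.
Proof. by rewrite raddfD /= pi_tensorZ. Qed.

Lemma tens_linearl b : linear (tens^~ b).
Proof.
move=> c a a'; rewrite /tens -pi_tensorP; apply/tensor_eqP/asboolP.
exact/tensor_null_rel/bilinear_rel_l.
Qed.

Lemma tens_linearr a : linear (tens a).
Proof.
move=> c b b'; rewrite /tens -pi_tensorP; apply/tensor_eqP/asboolP.
exact/tensor_null_rel/bilinear_rel_r.
Qed.

HB.instance Definition _ a :=
  GRing.isLinear.Build K B tensor *:%R (tens a) (tens_linearr a).

Lemma tens0l b : tens 0 b = 0.
Proof.
have := tens_linearl b (-1) 0 0; rewrite scaler0 add0r => ->.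
by rewrite scaleN1r addNr.
Qed.

Lemma tens_suml (I : Type) (r : seq I) (f : I -> A) b :
  tens (\sum_(i <- r) f i) b = \sum_(i <- r) tens (f i) b.
Proof.
elim: r => [|i r IH]; first by rewrite !big_nil tens0l.
by rewrite !big_cons -IH -[f i]scale1r tens_linearl !scale1r.
Qed.

Lemma tensor_ind (P : tensor -> Prop) :
  P 0 -> (forall c a b z, P z -> P (c *: tens a b + z)) -> forall z, P z.
Proof.
move=> P0 PD z; rewrite -[z]reprK; move: (repr z) => x.
elim/freeg_ind_dom0: x => [|c [a b] x _ _ IH]; first by rewrite raddf0.
have -> : << c *g (a, b) >> = c *: gen a b by rewrite fgscaleU mulr1.
by rewrite pi_tensorP; apply: PD.
Qed.

(* The universal property: bilinear maps factor uniquely through tens. *)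
Section Lift.
Variables (U : lmodType K) (f : A -> B -> U).
Hypothesis fl : forall b, linear (f^~ b).
Hypothesis fr : forall a, linear (f a).

Let lift0 := fglift (fun p : A * B => f p.1 p.2).

Let lift0P c (x y : F) : lift0 (c *: x + y) = c *: lift0 x + lift0 y.
Proof.
have liftB : {morph lift0 : u v / u - v}.
  exact: (lift_is_additive (fun p : A * B => f p.1 p.2)).
have lift00 : lift0 0 = 0 by rewrite -(subrr 0) liftB subrr.
have liftD : {morph lift0 : u v / u + v}.
  by move=> u v; rewrite -{1}[v]opprK -[- v]sub0r !liftB lift00 sub0r opprK.
rewrite liftD; congr (_ + _); move: x.
elim/freeg_ind_dom0 => [|k p x _ _ IH]; first by rewrite scaler0 lift00 scaler0.
rewrite scalerDr !liftD IH scalerDr; congr (_ + _).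
by rewrite fgscaleU /lift0 !liftU scalerA.
Qed.

Let lift0_null z : tensor_null z -> lift0 z = 0.
Proof.
have l0 : lift0 0 = 0.
  by have := lift0P (-1) 0 0; rewrite scaler0 add0r scaleN1r addNr.
have lgen a b : lift0 (gen a b) = f a b by rewrite /lift0 liftU scale1r.
have lB u v : lift0 (u - v) = lift0 u - lift0 v.
  by rewrite [u - v]addrC -[- v]scaleN1r lift0P scaleN1r addrC.
elim=> [//|c r {}z hr _ IH]; rewrite lift0P IH addr0.
by case: hr => *; rewrite lB lift0P !lgen ?fl ?fr subrr scaler0.
Qed.

Definition tlift (z : tensor) : U := lift0 (repr z).

Let tlift_pi (x : F) : tlift (\pi_tensor x) = lift0 x.
Proof.
have /tensor_eqP/asboolP/lift0_null h : \pi_tensor (repr (\pi_tensor x)) = \pi_tensor x.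
  by rewrite reprK.
apply/eqP; rewrite -subr_eq0 /tlift; apply/eqP; rewrite -h.
by rewrite [_ - x]addrC -[- x]scaleN1r lift0P scaleN1r addrC.
Qed.

Lemma tlift_is_linear : linear tlift.
Proof.
by move=> c x y; have := tlift_pi (c *: repr x + repr y); rewrite lift0P pi_tensorP !reprK.
Qed.

Lemma tlift_tens a b : tlift (tens a b) = f a b.
Proof. by rewrite tlift_pi /lift0 liftU scale1r. Qed.

Lemma tlift_unique (g : tensor -> U) :
  linear g -> (forall a b, g (tens a b) = f a b) -> g =1 tlift.
Proof.
move=> gl gt; have lin0 (h : tensor -> U) : linear h -> h 0 = 0.
  by move=> hl; have := hl (-1) 0 0; rewrite scaler0 add0r scaleN1r addNr.
elim/tensor_ind => [|c a b z IH].
  by rewrite !lin0 //; apply: tlift_is_linear.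
by rewrite gl tlift_is_linear gt tlift_tens IH.
Qed.

End Lift.
End Tensor.

Notation "a ⊗ b" := (tens a b) (at level 40, left associativity) : ring_scope.

(* The grading of a tensor product:
   (A (x) B)_n = \bigoplus_(i + j = n) A_i (x) B_j. *)
Section GradedTensor.
Variables (K : fieldType) (A B : gradedType K).

Definition thcomp2 (n : int) (a : A) (b : B) : tensor A B :=
  \sum_(i <- gsupp a) hcomp i a ⊗ hcomp (n - i) b.

Definition thcomp (n : int) : tensor A B -> tensor A B := tlift (thcomp2 n).

Let thcomp2_supp n a b (s : seq int) :
  uniq s -> (forall i, i \notin s -> hcomp i a = 0) ->
  thcomp2 n a b = \sum_(i <- s) hcomp i a ⊗ hcomp (n - i) b.
Proof.
move=> us hs; apply: sum_gsupp => // i; first by move=> /hs ->; rewrite tens0l.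
by move=> ->; rewrite tens0l.
Qed.

Let thcomp2_linearl n b : linear (thcomp2 n ^~ b).
Proof.
move=> c a a'; set s := undup (gsupp a ++ gsupp a').
have us : uniq s by apply: undup_uniq.
have ha i : i \notin s -> hcomp i a = 0.
  rewrite mem_undup mem_cat negb_or => /andP[h _].
  exact: hcomp_out (gsupp_sum a) h.
have ha' i : i \notin s -> hcomp i a' = 0.
  rewrite mem_undup mem_cat negb_or => /andP[_ h].
  exact: hcomp_out (gsupp_sum a') h.
have haa i : i \notin s -> hcomp i (c *: a + a') = 0.
  by move=> h; rewrite linearP /= ha ?ha' // scaler0 addr0.
rewrite !(thcomp2_supp n b us) // scaler_sumr -big_split /=.
by apply: eq_bigr => i _; rewrite linearP /= tens_linearl.
Qed.

Let thcomp2_linearr n a : linear (thcomp2 n a).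
Proof.
move=> c b b'; rewrite /thcomp2 scaler_sumr -big_split /=.
by apply: eq_bigr => i _; rewrite !linearP.
Qed.

Lemma thcomp_is_linear n : linear (thcomp n).
Proof. by apply: tlift_is_linear; [apply: thcomp2_linearl | apply: thcomp2_linearr]. Qed.

HB.instance Definition _ n :=
  GRing.isLinear.Build K (tensor A B) (tensor A B) *:%R (thcomp n) (thcomp_is_linear n).

Lemma thcomp_tens n a b : thcomp n (a ⊗ b) = thcomp2 n a b.
Proof. by apply: tlift_tens; [apply: thcomp2_linearl | apply: thcomp2_linearr]. Qed.

Lemma thcomp_homogeneous n i j a b : homogeneous i a -> homogeneous j b ->
  thcomp n (a ⊗ b) = if n == i + j then a ⊗ b else 0.
Proof.
move=> ha hb; rewrite thcomp_tens (@thcomp2_supp n a b [:: i]) //; last first.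
  by move=> k; rewrite inE (hcomp_homogeneous _ ha) => /negbTE->.
rewrite big_seq1 ha (hcomp_homogeneous _ hb) subr_eq [j + i]addrC.
by case: eqP => // _; rewrite linear0.
Qed.

Lemma thcomp_thcomp m n z :
  thcomp m (thcomp n z) = if m == n then thcomp n z else 0.
Proof.
elim/tensor_ind: z => [|c a b z IH]; first by rewrite !linear0 if_same.
rewrite !thcomp_is_linear IH thcomp_tens /thcomp2 linear_sum /=.
suff -> : \sum_(i <- gsupp a) thcomp m (hcomp i a ⊗ hcomp (n - i) b) =
   if m == n then \sum_(i <- gsupp a) hcomp i a ⊗ hcomp (n - i) b else 0.
  by case: eqP => // _; rewrite scaler0 addr0.
under eq_bigr => i _.
  rewrite (thcomp_homogeneous _ (homogeneous_hcomp _ _) (homogeneous_hcomp _ _)).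
  rewrite addrC subrK; over.
by case: eqP => // _; rewrite big1.
Qed.

Lemma thcomp_sum z : exists s : seq int, uniq s /\ z = \sum_(i <- s) thcomp i z.
Proof.
pose Q z := exists s : seq int, uniq s /\ z = \sum_(i <- s) thcomp i z.
have out x s i : x = \sum_(j <- s) thcomp j x -> i \notin s -> thcomp i x = 0.
  move=> -> his; rewrite linear_sum /= big_seq big1 // => j js.
  by rewrite thcomp_thcomp; case: eqP his => // ->; rewrite js.
have ext x s t : x = \sum_(j <- s) thcomp j x -> uniq s -> uniq t ->
    {subset s <= t} -> x = \sum_(j <- t) thcomp j x.
  move=> xs us ut st; rewrite [LHS]xs [RHS](bigID (fun i => i \in s)) /=.
  rewrite [X in _ + X]big1 ?addr0; last by move=> i; apply: out.
  rewrite -[RHS]big_filter; apply: perm_big.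
  apply: uniq_perm; rewrite ?filter_uniq // => i; rewrite mem_filter.
  by case: (boolP (i \in s)) => // /st ->.
have Q0 : Q 0 by exists [::]; rewrite big_nil.
have QP c x y : Q x -> Q y -> Q (c *: x + y).
  move=> [s [us hs]] [t [ut ht]]; exists (undup (s ++ t)).
  rewrite undup_uniq; split=> //.
  have us' := undup_uniq (s ++ t).
  have sx : {subset s <= undup (s ++ t)} by move=> i; rewrite mem_undup mem_cat => ->.
  have sy : {subset t <= undup (s ++ t)}.
    by move=> i; rewrite mem_undup mem_cat orbC => ->.
  have hx := ext x s _ hs us us' sx; have hy := ext y t _ ht ut us' sy.
  rewrite [LHS](congr2 (fun u v => c *: u + v) hx hy).
  rewrite scaler_sumr -big_split /=; apply: eq_bigr => i _.
  by rewrite thcomp_is_linear.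
have Qsum (I : Type) (r : seq I) (G : I -> tensor A B) :
    (forall i, Q (G i)) -> Q (\sum_(i <- r) G i).
  move=> QG; elim: r => [|i r IH]; first by rewrite big_nil.
  by rewrite big_cons -[G i]scale1r; apply: QP.
elim/tensor_ind: z => // c a b z Qz; apply: QP Qz.
rewrite (gsupp_sum a) tens_suml; apply: (Qsum) => i.
rewrite (gsupp_sum b) linear_sum; apply: (Qsum) => j /=.
exists [:: i + j]; split=> //; rewrite big_seq1.
by rewrite (thcomp_homogeneous _ (homogeneous_hcomp i a) (homogeneous_hcomp j b)) eqxx.
Qed.

HB.instance Definition _ := isGraded.Build K (tensor A B)
  thcomp_is_linear thcomp_thcomp thcomp_sum.

Lemma homogeneous_tens i j (a : A) (b : B) :
  homogeneous i a -> homogeneous j b -> homogeneous (i + j) (a ⊗ b).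
Proof.
by move=> ha hb; rewrite /homogeneous [LHS](thcomp_homogeneous _ ha hb) eqxx.
Qed.

End GradedTensor.

Definition args (n : nat) (T : Type) (x : 'I_n -> T) : seq T :=
  [seq x i | i <- enum 'I_n].

(* A linear map S^k(V) -> W is a k-multilinear graded symmetric map
   V^k -> W (graded symmetric: it vanishes on the relations
   x y - (-1)^(|x||y|) y x that define S^k(V) as a quotient of V^{(x)k}).
   A family of such maps, one for each k >= 1, is one function seq V -> W,
   its k-th member being the restriction to sequences of size k. *)
Section Multilinear.
Variables (K : fieldType) (V W : gradedType K).

Definition multilinear (f : seq V -> W) : Prop :=
  forall (c : K) (x y : V) (s t : seq V),
    f (s ++ (c *: x + y) :: t) = c *: f (s ++ x :: t) + f (s ++ y :: t).

Definition graded_symmetric (f : seq V -> W) : Prop :=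
  forall (i j : int) (x y : V) (s t : seq V), homogeneous i x -> homogeneous j y ->
    f (s ++ x :: y :: t) = (-1) ^ (i * j) *: f (s ++ y :: x :: t).

Definition has_degree (e : int) (f : seq V -> W) : Prop :=
  forall (k : nat) (x : 'I_k -> V) (d : 'I_k -> int), (0 < k)%N ->
    (forall i, homogeneous (d i) (x i)) ->
    homogeneous (e + \sum_(i < k) d i) (f (args x)).

End Multilinear.

(* s is a b-shuffle: it is increasing on each of the consecutive blocks of
   sizes b_1, ..., b_k of {0, ..., n-1}, where b_1 + ... + b_k = n. *)
Definition shuffle (b : seq nat) (n : nat) (s : 'S_n) : bool :=
  [forall i : 'I_n, forall j : 'I_n,
     (i < j)%N && (reshape_index b i == reshape_index b j) ==> (s i < s j)%N].

(* The sign with v_1 ... v_n = koszul d s v_(s 1) ... v_(s n) in S(V) for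
   |v_i| = d i: each inversion of s exchanges two factors once. *)
Definition koszul (K : fieldType) (n : nat) (d : 'I_n -> int) (s : 'S_n) : K :=
  \prod_(i < n) \prod_(j < n | (i < j)%N && (s j < s i)%N) (-1) ^ (d (s i) * d (s j)).

Section Structures.
Variables (K : fieldType) (V : gradedType K).

Record Linfty_algebra (l : seq V -> V) : Prop := {
  Linfty_multilinear : multilinear l;
  Linfty_symmetric : graded_symmetric l;
  Linfty_degree : has_degree 1 l;
  Linfty_identity : forall (n : nat) (x : 'I_n -> V) (d : 'I_n -> int),
    (0 < n)%N -> (forall i, homogeneous (d i) (x i)) ->
    \sum_(1 <= i < n.+1) \sum_(s : 'S_n | shuffle [:: i; n - i]%N s)
      (let xs := args (fun u => x (s u)) in
       koszul K d s *: l (l (take i xs) :: drop i xs)) = 0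
}.

(* No unit is required. *)
Record graded_comm_algebra (mul : V -> V -> V) : Prop := {
  gmul_linearl : forall y, linear (mul ^~ y);
  gmul_linearr : forall x, linear (mul x);
  gmul_degree : forall i j x y, homogeneous i x -> homogeneous j y ->
    homogeneous (i + j) (mul x y);
  gmulA : associative mul;
  gmulC : forall i j x y, homogeneous i x -> homogeneous j y ->
    mul x y = (-1) ^ (i * j) *: mul y x
}.

Record homotopy_Poisson_algebra (mul : V -> V -> V) (l : seq V -> V) : Prop := {
  hPoisson_comm_algebra : graded_comm_algebra mul;
  hPoisson_Linfty : Linfty_algebra l;
  hPoisson_leibniz : forall (k : nat) (x : 'I_k -> V) (d : 'I_k -> int) (e : int) (y z : V),
    (forall i, homogeneous (d i) (x i)) -> homogeneous e y ->
    l (rcons (args x) (mul y z)) =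
      mul (l (rcons (args x) y)) z
      + (-1) ^ (e * (1 + \sum_(i < k) d i)) *: mul y (l (rcons (args x) z))
}.

(* M xs ys is M_{p,q}(xs (x) ys), where p = size xs >= 0 and
   q = size ys >= 1; nothing is required of M xs [::]. *)
Record post_Lie_infty_algebra (M : seq V -> seq V -> V) : Prop := {
  postLie_multilinearl : forall ys, (0 < size ys)%N -> multilinear (M ^~ ys);
  postLie_multilinearr : forall xs, multilinear (M xs);
  postLie_symmetricl : forall ys, (0 < size ys)%N -> graded_symmetric (M ^~ ys);
  postLie_symmetricr : forall xs, graded_symmetric (M xs);
  postLie_degree : forall (p q : nat) (x : 'I_p -> V) (y : 'I_q -> V)
      (dx : 'I_p -> int) (dy : 'I_q -> int), (0 < q)%N ->
    (forall i, homogeneous (dx i) (x i)) -> (forall i, homogeneous (dy i) (y i)) ->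
    homogeneous (1 + (\sum_(i < p) dx i + \sum_(i < q) dy i)) (M (args x) (args y));
  (* x_(n+1), ..., x_(n+m) are called y_1, ..., y_m. *)
  postLie_identity : forall (n m : nat) (x : 'I_n -> V) (y : 'I_m -> V)
      (dx : 'I_n -> int) (dy : 'I_m -> int), (0 < m)%N ->
    (forall i, homogeneous (dx i) (x i)) -> (forall i, homogeneous (dy i) (y i)) ->
    \sum_(0 <= j < n) \sum_(1 <= i < n.+1 | (i + j <= n)%N)
      \sum_(s : 'S_n | shuffle [:: j; i; n - j - i]%N s)
        (let xs := args (fun u => x (s u)) in
         koszul K dx s *:
           M (M (take j xs) (take i (drop j xs)) :: drop (j + i)%N xs) (args y))
    + \sum_(0 <= j < n.+1) \sum_(s : 'S_n | shuffle [:: n - j; j]%N s)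
      \sum_(1 <= i < m.+1) \sum_(t : 'S_m | shuffle [:: i; m - i]%N t)
        (let xs := args (fun u => x (s u)) in
         let ys := args (fun u => y (t u)) in
         (koszul K dx s * koszul K dy t
            * (-1) ^ (\sum_(u < n | (u < n - j)%N) dx (s u))) *:
           M (take (n - j)%N xs) (M (drop (n - j)%N xs) (take i ys) :: drop i ys))
    = 0
}.

End Structures.

(* x_1 ... x_n for n >= 1; the value at [::] is junk. *)
Definition mulseq (T : nmodType) (mul : T -> T -> T) (s : seq T) : T :=
  if s is x :: s' then foldl mul x s' else 0.

(* \sum_(i = 1)^n (1 + |x_1| + ... + |x_(i-1)|) |a_i| *)
Definition tens_sign_exp (n : nat) (da dx : 'I_n -> int) : int :=
  \sum_(i < n) (1 + \sum_(j < n | (j < i)%N) dx j) * da i.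

(* Main.v *)
(** Attach a letter to each of the homogeneous elements [a_i], [x_i] and a letter
   of degree 1 to each of the two operations occurring in a term. Every term of
   the identities is then its value multiplied by the Koszul sign of its word of
   letters, and graded symmetry, the Leibniz rule and the L-infinity identity all
   become sign free. Write [M = N + N0] with the action
   [N (I; b ⊗ y) = a_I l(x_I, b) ⊗ y] and the bracket [N0 (I) = a_I ⊗ l(x_I)].
   The post-Lie identity is the sum of three identities.
   - [N0 N0 = 0] is the L-infinity identity in the second factor.
   - [N (xs; N0 ys)] cancels [N0 (N (xs; y_k), ...)] by the Leibniz rule: the
     terms agree but for the order of the two operations, which are odd.
   - In [N (I; N (J; y))] the Leibniz rule expands [l(x_I, a_J l(x_J, a'))]. The
     terms where [l] hits a factor [a_k] cancel the terms [N (N (I; k), ...; y)];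
     the remaining one, together with [N (N0 I, ...; y)], gives the L-infinity
     identity for [x_1, ..., x_n, a']. *)

Require Import Defs.
From mathcomp Require Import all_boot all_order all_fingroup all_algebra.
From mathcomp Require Import ring zify boolp.

Set Implicit Arguments.
Unset Strict Implicit.
Unset Printing Implicit Defensive.

Import Order.TTheory GRing.Theory.
Local Open Scope ring_scope.

(** * Koszul signs of words *)

(** A value alone forgets which elements it was made of and in what order, so signs are compared
    through words over one totally ordered alphabet. Moving a letter costs the sign that graded
    symmetry or the Leibniz rule produces, and the two cancel. The signs of the theorem have the
    same origin: $1+x_1+\cdots+x_{i-1}$ is the total degree of the letters that $a_i$ crosses,
    namely that of the operation and those of $x_1,\ldots,x_{i-1}$. The formula for $M_{0,1}$ is no
    exception either: $N(\emptyset; a ⊗ x) = l_1(a) ⊗ x$ and $N0(a ⊗ x) = (-1)^a a ⊗ l_1(x)$. Words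
    exist only for pure tensors of homogeneous elements, whereas the operations must be defined on
    all of $A ⊗ A$. They are therefore built by a multilinear extension, and multilinearity of the
    identity reduces it to pure homogeneous arguments. There every letter occurs once, so the sign
    of the reference word is invertible and can be multiplied into the identity. Sums over shuffles
    and block sizes become sums over splittings of a word into complementary subwords. These obey
    simple recursions, which separate the terms according to the place of a chosen letter. *)

Section SignPowers.
Variable K : fieldType.
Implicit Types i j : int.

Lemma signzD i j : (-1 : K) ^ (i + j) = (-1) ^ i * (-1) ^ j.
Proof. by rewrite expfzDr ?oppr_eq0 ?oner_eq0. Qed.

Lemma signz_sqr i : (-1 : K) ^ i * (-1) ^ i = 1.
Proof. by rewrite -expfzMl mulrNN mulr1 exp1rz. Qed.

Lemma signzP i : (-1 : K) ^ i = 1 \/ (-1 : K) ^ i = -1.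
Proof.
have /eqP := signz_sqr i; rewrite -expr2 -subr_eq0 subr_sqr_1 mulf_eq0.
by rewrite subr_eq0 addr_eq0 => /orP[] /eqP; [left | right].
Qed.

Lemma signz_neq0 i : (-1 : K) ^ i != 0.
Proof. by case: (signzP i) => ->; rewrite ?oppr_eq0 oner_eq0. Qed.

End SignPowers.

Section KoszulSign.
Variables (disp : Order.disp_t) (L : orderType disp) (K : fieldType) (D : L -> int).
Implicit Types (x y : L) (u v w : seq L).

Definition wdeg w : int := \sum_(x <- w) D x.

Lemma wdeg_cons x w : wdeg (x :: w) = D x + wdeg w.
Proof. exact: big_cons. Qed.

Lemma wdeg_cat u v : wdeg (u ++ v) = wdeg u + wdeg v.
Proof. exact: big_cat. Qed.

(* The Koszul sign of sorting the word [w]. The value 0 on words with a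
   repeated letter makes the exchange rule [wsign_swap] unconditional. *)
Fixpoint wsign w : K :=
  if w is x :: w' then
    (if x \in w' then 0 else \prod_(y <- w' | (y < x)%O) (-1) ^ (D x * D y)) * wsign w'
  else 1.

Lemma wsign_cons x w : wsign (x :: w) =
  (if x \in w then 0 else \prod_(y <- w | (y < x)%O) (-1) ^ (D x * D y)) * wsign w.
Proof. by []. Qed.

Lemma wsign_swap2 u x y v :
  wsign (u ++ x :: y :: v) = (-1) ^ (D x * D y) * wsign (u ++ y :: x :: v).
Proof.
elim: u => [|z u IH] /=; last first.
  rewrite IH [RHS]mulrCA; congr (_ * _).
  have p : perm_eq (u ++ [:: x, y & v]) (u ++ [:: y, x & v]).
    by rewrite perm_cat2l -(cat1s x) -(cat1s y) perm_catCA.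
  by rewrite (perm_mem p) (perm_big _ p).
rewrite !inE !big_cons [y == x]eq_sym.
case: (ltgtP x y) => [xy|yx|->] /=; last first.
- by rewrite !mul0r mulr0.
- case: (x \in v); case: (y \in v); rewrite ?mul0r ?mulr0 //; ring.
- case: (x \in v); case: (y \in v); rewrite ?mul0r ?mulr0 //.
  rewrite [D y * D x]mulrC; have := signz_sqr K (D x * D y).
  by move: (_ ^ _) => e e2; rewrite !mulrA e2; ring.
Qed.

Lemma wsign_swap w1 u v w2 :
  wsign (w1 ++ u ++ v ++ w2) = (-1) ^ (wdeg u * wdeg v) * wsign (w1 ++ v ++ u ++ w2).
Proof.
have swap1 w x v' w' : wsign (w ++ x :: v' ++ w') =
    (-1) ^ (D x * wdeg v') * wsign (w ++ v' ++ x :: w').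
  elim: v' w => [|y v' IH] w; first by rewrite /wdeg big_nil mulr0 mul1r.
  rewrite /= wsign_swap2 -cat_rcons IH cat_rcons wdeg_cons mulrDr signzD.
  by rewrite mulrA.
elim: u w1 => [|x u IH] w1 /=; first by rewrite /wdeg big_nil mul0r mul1r.
by rewrite -cat_rcons IH cat_rcons swap1 wdeg_cons mulrDl signzD mulrCA mulrA.
Qed.

(** Distinct letters make the sign invertible: this is what allows an identity to be multiplied by
    the sign of a reference word. *)
Lemma wsign_uniq w : (wsign w != 0) = uniq w.
Proof.
elim: w => [|x w IH] /=; first by rewrite oner_eq0.
rewrite mulf_eq0 negb_or IH; case: (x \in w); rewrite ?eqxx //=.
by rewrite prodf_seq_neq0; case: (uniq w); rewrite ?andbF // andbT;
  apply/allP => y _; rewrite signz_neq0 implybT.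
Qed.

(* Exchanging two odd letters contributes only their own sign, the letters
   between them being crossed twice. *)
Lemma wsign_odd_letters w1 w2 w3 x y : D x = 1 -> D y = 1 ->
  wsign (w1 ++ x :: w2 ++ y :: w3) = - wsign (w1 ++ y :: w2 ++ x :: w3).
Proof.
move=> dx dy.
rewrite -[x :: w2 ++ _]cat1s -[y :: w2 ++ _]cat1s !(catA w1).
rewrite -[y :: w3]cat1s -[x :: w3]cat1s wsign_swap [in RHS]wsign_swap.
rewrite -!catA /= wsign_swap2 dx dy /wdeg !big_seq1 dx dy mul1r expr1z; ring.
Qed.

Lemma wsign_sq w : uniq w -> wsign w * wsign w = 1.
Proof.
elim: w => [|x w IH] /=; first by rewrite mulr1.
case/andP => /negbTE-> /IH; rewrite mulrACA => ->; rewrite mulr1.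
rewrite -big_split big1 //= => y _; exact: signz_sqr.
Qed.

End KoszulSign.

Arguments wsign : simpl never.

Section PermInvariance.
Variable T : eqType.

(** Adjacent transpositions generate all permutations. Graded symmetry is given on neighbours only,
    and this extends its consequences to arbitrary reorderings. *)
Lemma perm_swap_invariant (R : Type) (F : seq T -> R) :
  (forall u x y v, F (u ++ x :: y :: v) = F (u ++ y :: x :: v)) ->
  forall s t, perm_eq s t -> F s = F t.
Proof.
move=> Fswap.
have Fmove u s x t : F (u ++ x :: s ++ t) = F (u ++ s ++ x :: t).
  elim: s u => //= y s IH u; rewrite Fswap -cat_rcons IH cat_rcons //.
(* The prefix [u] collects the letters already matched, because [F] sees only whole words. *)
suff H u s t : perm_eq s t -> F (u ++ s) = F (u ++ t) by move=> s t; apply: (H [::]).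
elim: s u t => [|x s IH] u t.
  by move=> /perm_size /esym/eqP; rewrite size_eq0 => /eqP->.
move=> p; have xt : x \in t by rewrite -(perm_mem p) mem_head.
case/splitPr: xt p => t1 t2; rewrite perm_sym -[x :: t2]cat1s perm_catCA /= perm_cons.
move=> p; rewrite -Fmove -cat_rcons (IH _ (t1 ++ t2)) ?cat_rcons //.
by rewrite perm_sym.
Qed.

End PermInvariance.

(** * Splittings of words and shuffles *)

Section Splits.
Variable T : Type.
Implicit Types w : seq T.

(** The terms of the unshuffle coproduct of a word, without signs: all pairs of complementary
    subwords. [picks] lists those whose first part is a single letter. *)
Fixpoint splits w : seq (seq T * seq T) :=
  if w is x :: w' then
    [seq (x :: p.1, p.2) | p <- splits w'] ++ [seq (p.1, x :: p.2) | p <- splits w']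
  else [:: ([::], [::])].

Fixpoint picks w : seq (T * seq T) :=
  if w is x :: w' then (x, w') :: [seq (p.1, x :: p.2) | p <- picks w'] else [::].

Lemma big_splits_cons (U : nmodType) (F : seq T * seq T -> U) x w :
  \sum_(p <- splits (x :: w)) F p =
  \sum_(p <- splits w) F (x :: p.1, p.2) + \sum_(p <- splits w) F (p.1, x :: p.2).
Proof. by rewrite /= big_cat !big_map. Qed.

Lemma big_splits_rcons (U : nmodType) (F : seq T * seq T -> U) x w :
  \sum_(p <- splits (rcons w x)) F p =
  \sum_(p <- splits w) F (rcons p.1 x, p.2) + \sum_(p <- splits w) F (p.1, rcons p.2 x).
Proof.
elim: w F => [|y w IH] F; first by rewrite /= !big_cons !big_nil !addr0.
rewrite rcons_cons !big_splits_cons !IH /=; exact: addrACA.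
Qed.

Lemma big_splitsC (U : nmodType) (F : seq T * seq T -> U) w :
  \sum_(p <- splits w) F p = \sum_(p <- splits w) F (p.2, p.1).
Proof.
elim: w F => [|y w IH] F; first by rewrite /= !big_seq1.
by rewrite !big_splits_cons addrC IH [X in _ + X]IH.
Qed.

Lemma big_splits_nil1 (U : nmodType) (F : seq T * seq T -> U) w :
  \sum_(p <- splits w | nilp p.1) F p = F ([::], w).
Proof.
elim: w F => [|y w IH] F; first by rewrite /= big_cons big_nil /= addr0.
by rewrite /= big_cat !big_map /= big_pred0_eq add0r IH.
Qed.

Lemma big_splits_nil2 (U : nmodType) (F : seq T * seq T -> U) w :
  \sum_(p <- splits w | nilp p.2) F p = F (w, [::]).
Proof.
elim: w F => [|y w IH] F; first by rewrite /= big_cons big_nil /= addr0.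
by rewrite /= big_cat !big_map /= big_pred0_eq addr0 IH.
Qed.

Lemma big_splits_size1 (U : nmodType) (F : seq T * seq T -> U) w :
  \sum_(p <- splits w | size p.1 == 1%N) F p = \sum_(p <- picks w) F ([:: p.1], p.2).
Proof.
elim: w F => [|y w IH] F; first by rewrite /= big_cons !big_nil.
by rewrite /= big_cat big_cons !big_map /= big_splits_nil1 IH.
Qed.

Lemma big_picks_rcons (U : nmodType) (F : T * seq T -> U) x w :
  \sum_(p <- picks (rcons w x)) F p =
  \sum_(p <- picks w) F (p.1, rcons p.2 x) + F (x, w).
Proof.
elim: w F => [|y w IH] F; first by rewrite /= big_seq1 big_nil add0r.
by rewrite rcons_cons /= !big_cons !big_map IH addrA.
Qed.

End Splits.

Section SplitsMap.
Variables (T T' : Type) (f : T -> T').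

Lemma splits_map w :
  splits (map f w) = [seq (map f p.1, map f p.2) | p <- splits w].
Proof. by elim: w => //= x w ->; rewrite map_cat -!map_comp. Qed.

Lemma picks_map w :
  picks (map f w) = [seq (f p.1, map f p.2) | p <- picks w].
Proof. by elim: w => //= x w ->; rewrite -!map_comp. Qed.

End SplitsMap.

Section SplitsEq.
Variable T : eqType.
Implicit Types (w : seq T).

Lemma splits_perm w p : p \in splits w -> perm_eq (p.1 ++ p.2) w.
Proof.
elim: w p => [|x w IH] p /=; first by rewrite inE => /eqP->.
rewrite mem_cat => /orP[] /mapP[q /IH qw ->] /=; first by rewrite perm_cons.
by rewrite -(cat1s x) perm_catCA /= perm_cons.
Qed.

Lemma picks_perm w p : p \in picks w -> perm_eq (p.1 :: p.2) w.
Proof.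
elim: w p => [|x w IH] p //=; rewrite inE => /orP[/eqP-> //|/mapP[q /IH qw ->]] /=.
rewrite -(cat1s x) -(cat1s q.1) perm_catCA /= perm_cons //.
Qed.

Lemma big_splits_full (U : nmodType) (F : seq T * seq T -> U) w :
  \sum_(p <- splits w | size p.1 == size w) F p = F (w, [::]).
Proof.
rewrite -big_splits_nil2 big_seq_cond [RHS]big_seq_cond; apply: eq_bigl => p.
case: (boolP (p \in _)) => //= /splits_perm/perm_size <-.
by rewrite size_cat -{1}[size _]addn0 eqn_add2l eq_sym.
Qed.

Lemma splits_uniq w : uniq w -> uniq (splits w).
Proof.
elim: w => //= x w IH /andP[xw /IH uw].
rewrite cat_uniq !map_inj_uniq ?uw; try by move=> [? ?] [? ?] [-> ->].
rewrite andbT /=; apply/hasPn => p /mapP[q /splits_perm/perm_mem qw ->].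
apply/mapP => -[r _ [e _]]; move: xw; rewrite -qw e mem_cat /=.
by rewrite mem_head.
Qed.

End SplitsEq.

Section SortedSplits.
Variables (disp : Order.disp_t) (L : orderType disp).
Implicit Types (w u v : seq L) (b : seq nat).
Local Notation sorted := (sorted <%O).

(** The least letter of [w] must come first in whichever part contains it, which is exactly the
    choice made by the recursion of [splits]. *)
Lemma mem_splits w p : sorted w ->
  (p \in splits w) = [&& perm_eq (p.1 ++ p.2) w, sorted p.1 & sorted p.2].
Proof.
case: p => u v /=; elim: w u v => [|x w IH] u v /= sw.
  rewrite inE; apply/eqP/idP => [[-> ->]//|/andP[/perm_size/eqP]].
  by rewrite size_cat addn_eq0 !size_eq0 => /andP[/eqP-> /eqP->].
have xw y : y \in w -> (x < y)%O by have/allP := order_path_min lt_trans sw; apply.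
have {}IH := IH _ _ (path_sorted sw).
have uw : uniq (x :: w) by apply: lt_sorted_uniq.
have pos s t : perm_eq (s ++ t) (x :: w) -> sorted s -> x \in s -> exists s', s = x :: s'.
  case: s => // y s p ss; rewrite inE; case: eqP => [-> _|/eqP xy xs]; first by exists s.
  have yx : (y < x)%O by have/allP := order_path_min lt_trans ss; apply.
  have : y \in x :: w by rewrite -(perm_mem p) mem_head.
  by rewrite inE eq_sym (negbTE xy) => /xw; rewrite ltNge (ltW yx).
have sx t : {subset t <= w} -> path <%O x t = sorted t.
  move=> tw; rewrite path_sortedE //; last exact: lt_trans.
  by rewrite -[RHS]andTb; congr (_ && _); apply/allP => y /tw/xw.
rewrite mem_cat; apply/idP/idP.
  case/orP=> /mapP[[u' v']]; rewrite IH /= => /and3P[p su sv] [-> ->].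
  - rewrite /= perm_cons p sv sx ?su // => y yu.
    by rewrite -(perm_mem p) mem_cat yu.
  rewrite -(cat1s x) perm_catCA /= perm_cons p su sx ?sv // => y yu.
  by rewrite -(perm_mem p) mem_cat yu orbT.
case/and3P=> p su sv; have : x \in u ++ v by rewrite (perm_mem p) mem_head.
rewrite mem_cat => /orP[xu|xv].
  have [u' e] := pos _ _ p su xu; apply/orP; left; apply/mapP; exists (u', v); rewrite ?e //=.
  rewrite e in p su; rewrite /= perm_cons in p; rewrite IH p sv (path_sorted su) //.
have p' : perm_eq (v ++ u) (x :: w) by rewrite perm_catC.
have [v' e] := pos _ _ p' sv xv; apply/orP; right; apply/mapP; exists (u, v'); rewrite ?e //=.
rewrite e in p' sv; rewrite /= perm_cons perm_catC in p'.
by rewrite IH p' su (path_sorted sv).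
Qed.

(** Iterated splitting with prescribed block sizes; on a sorted word it yields the one-line
    notations of the [b]-shuffles. *)
Fixpoint split_words b w : seq (seq L) :=
  if b is c :: b' then
    [seq p.1 ++ v | p <- [seq p <- splits w | size p.1 == c], v <- split_words b' p.2]
  else [:: [::]].

Lemma big_split_words (U : nmodType) c b w (F : seq L -> U) :
  \sum_(v <- split_words (c :: b) w) F v =
  \sum_(p <- splits w | size p.1 == c) \sum_(v <- split_words b p.2) F (p.1 ++ v).
Proof. by rewrite [LHS]big_allpairs_dep big_filter. Qed.

Lemma mem_split_words b w v : sorted w -> sumn b = size w ->
  (v \in split_words b w) = perm_eq v w && all sorted (reshape b v).
Proof.
elim: b w v => [|c b IH] w v sw /=.
  case: w sw => // _ _; rewrite inE andbT.
  by apply/idP/idP => [/eqP->//|/perm_size/eqP]; rewrite size_eq0.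
move=> sb; apply/allpairsPdep/idP.
  case=> -[p1 p2] [v' []]; rewrite mem_filter /= => /andP[/eqP sp1].
  rewrite mem_splits // => /and3P[/= p s1 s2].
  have sp := perm_size p; rewrite size_cat in sp.
  rewrite IH //; last by apply: (@addnI (size p1)); rewrite sp sp1.
  case/andP=> p' av ->; rewrite -sp1 take_size_cat // drop_size_cat // s1 av.
  by rewrite andbT (perm_trans _ p) // perm_cat2l.
case/and3P=> p s1 av; have sv := perm_size p.
have cv : (c <= size v)%N by rewrite sv -sb leq_addr.
(* The later blocks are drawn from the complement of the first block, which [splits] delivers in
   sorted order. *)
pose v2 := sort <=%O (drop c v).
have pv2 : perm_eq (drop c v) v2 by rewrite perm_sym perm_sort.
have uw : uniq w by apply: lt_sorted_uniq.
have sv2 : sorted v2.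
  rewrite lt_sorted_uniq_le sort_le_sorted andbT -(perm_uniq pv2) drop_uniq //.
  by rewrite (perm_uniq p).
exists (take c v, v2), (drop c v); rewrite cat_take_drop mem_filter /= size_takel //.
rewrite eqxx mem_splits //= s1 sv2 !andbT IH //; last first.
  by rewrite -(perm_size pv2) size_drop sv -sb addKn.
rewrite pv2 av /=; split=> //.
by rewrite (perm_trans _ p) // -{2}(cat_take_drop c v) perm_cat2l perm_sym.
Qed.

Lemma split_words_uniq b w : sorted w -> uniq (split_words b w).
Proof.
elim: b w => //= c b IH w sw.
have uw : uniq w by apply: lt_sorted_uniq.
apply: allpairs_uniq_dep.
- by rewrite filter_uniq ?splits_uniq.
- move=> p; rewrite mem_filter => /andP[_].
  by rewrite mem_splits // => /and3P[_ _ /IH].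
move=> _ _ /allpairsPdep[p [v [pw _ ->]]] /allpairsPdep[q [v' [qw _ ->]]] /=.
move: pw qw; rewrite !mem_filter !mem_splits //.
move=> /and4P[/eqP sp p1 p2 p3] /and4P[/eqP sq q1 q2 q3] /eqP.
rewrite eqseq_cat ?sp ?sq // => /andP[/eqP e /eqP ->].
suff -> : p = q by [].
case: p q {sp sq p2 q2} e p1 p3 q1 q3 => [a p] [_ q] /= <- p1 p3 q1 q3; congr (_, _).
apply: (irr_sorted_eq lt_trans ltxx) => // x; apply: perm_mem.
by rewrite -(perm_cat2l a) (perm_trans p1) // perm_sym.
Qed.

Lemma reshape_index_cons c b i :
  reshape_index (c :: b) i = if (i < c)%N then 0 else (reshape_index b (i - c)).+1.
Proof.
rewrite /reshape_index /= subn_eq0; case: ltnP => //= ci.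
by rewrite subSn.
Qed.

(** Bridge to the definition of [shuffle], which speaks of positions with equal [reshape_index] and
    not of blocks. *)
Lemma sorted_reshapeP x0 b w : size w = sumn b ->
  reflect (forall i j, (i < j)%N -> (j < size w)%N ->
             reshape_index b i = reshape_index b j -> (nth x0 w i < nth x0 w j)%O)
          (all sorted (reshape b w)).
Proof.
elim: b w => [|c b IH] w /= sw; first by apply: ReflectT => i j _; rewrite sw.
have sd : size (drop c w) = sumn b by rewrite size_drop sw addKn.
have ct : size (take c w) = c by rewrite size_takel // sw leq_addr.
apply: (iffP andP) => [[s1 /(IH _ sd) s2] i j ij jw|h].
  rewrite !reshape_index_cons; case: (ltnP j c) => jc.
    rewrite (ltn_trans ij jc) => _; rewrite -(nth_take x0 jc) -(nth_take x0 (ltn_trans ij jc)).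
    move: s1; rewrite (sorted_pairwise lt_trans) => /(pairwiseP x0); apply; rewrite ?inE ?ct //.
    exact: ltn_trans ij jc.
  case: ltnP => // ic [e]; rewrite -(subnKC ic) -(subnKC jc) -!nth_drop; apply: s2 e.
    by rewrite ltn_sub2r // (leq_ltn_trans ic).
  by rewrite size_drop ltn_sub2r // (leq_ltn_trans jc).
split.
  rewrite (sorted_pairwise lt_trans); apply/(pairwiseP x0) => i j; rewrite !inE ct => ic jc ij.
  rewrite !nth_take //; apply: h => //; first by rewrite sw ltn_addr.
  by rewrite !reshape_index_cons ic jc.
apply/IH => // i j ij; rewrite size_drop ltn_subRL => jw e; rewrite !nth_drop; apply: h => //.
  by rewrite ltn_add2l.
by rewrite !reshape_index_cons !ltnNge !leq_addr /= !addKn e.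
Qed.

End SortedSplits.

(** * Shuffle permutations as splittings of the word of all indices *)

Section Shuffles.
Variable n : nat.

Definition perm_word (s : 'S_n) : seq 'I_n := [seq s i | i <- enum 'I_n].

Lemma size_perm_word s : size (perm_word s) = n.
Proof. by rewrite size_map size_enum_ord. Qed.

Lemma perm_word_inj : injective perm_word.
Proof.
move=> s t st; apply/permP => i.
by have /eq_in_map := st; apply; rewrite mem_enum.
Qed.

Lemma nth_perm_word x0 s (i : 'I_n) : nth x0 (perm_word s) i = s i.
Proof. by rewrite (nth_map i) ?size_enum_ord // nth_ord_enum. Qed.

Lemma perm_wordP w : reflect (exists s, w = perm_word s) (perm_eq w (enum 'I_n)).
Proof.
apply: (iffP idP) => [p|[s ->]]; last first.
  apply: uniq_perm; rewrite ?enum_uniq ?(map_inj_uniq (@perm_inj _ s)) ?enum_uniq //.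
  by move=> i; rewrite mem_enum; apply/mapP; exists (s^-1%g i); rewrite ?mem_enum ?permKV.
have sw : size w = n by rewrite (perm_size p) size_enum_ord.
have fi : injective (fun i : 'I_n => nth i w i).
  move=> i j; rewrite (set_nth_default i j) ?sw // => /eqP.
  by rewrite nth_uniq ?sw ?(perm_uniq p) ?enum_uniq // => /eqP/val_inj.
exists (perm fi); have [n0|n0] := posnP n.
  by rewrite [RHS]size0nil ?size_perm_word //; apply: size0nil; rewrite sw.
apply: (@eq_from_nth _ (Ordinal n0)) => [|i]; rewrite ?size_perm_word sw // => im.
rewrite -[i]/(val (Ordinal im)) nth_perm_word permE.
by apply: set_nth_default; rewrite sw.
Qed.

Lemma sorted_enum_ord : sorted <%O (enum 'I_n).
Proof.
have e : (<%O : rel 'I_n) =2 relpre val ltn by move=> i j; rewrite ltEord.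
by rewrite (eq_sorted e) -sorted_map val_enum_ord iota_ltn_sorted.
Qed.

Lemma shuffle_sorted (b : seq nat) s : sumn b = n ->
  shuffle b s = all (sorted <%O) (reshape b (perm_word s)).
Proof.
case: (posnP n) => [n0|]; last first.
  move=> n0 sb; have x0 : 'I_n := Ordinal n0.
  have sw : size (perm_word s) = sumn b by rewrite size_perm_word.
  apply/idP/(sorted_reshapeP x0 sw) => [/forallP h i j ij|h].
    rewrite size_perm_word => jn; have iN := ltn_trans ij jn => e.
    have := h (Ordinal iN) => /forallP/(_ (Ordinal jn))/implyP.
    rewrite -[i]/(val (Ordinal iN)) -[j]/(val (Ordinal jn)) !nth_perm_word ltEord /=.
    by apply; rewrite ij e eqxx.
  apply/forallP => i; apply/forallP => j; apply/implyP => /andP[ij /eqP e].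
  have := h i j ij; rewrite size_perm_word !nth_perm_word ltEord; exact.
move=> sb; have w0 : perm_word s = [::] by apply/nilP; rewrite /nilp size_perm_word n0.
rewrite w0; have -> : shuffle b s by apply/forallP => i; have := ltn_ord i; rewrite [X in (_ < X)%N]n0.
move: sb; rewrite n0; elim: b => //= c b IH /eqP; rewrite addn_eq0 => /andP[_ /eqP/IH->].
by [].
Qed.

(** One-line notation is a bijection from [b]-shuffles to [split_words]: both sides are
    duplicate-free lists with the same members. *)
Lemma big_shuffle (U : nmodType) (b : seq nat) (F : seq 'I_n -> U) : sumn b = n ->
  \sum_(s : 'S_n | shuffle b s) F (perm_word s) = \sum_(w <- split_words b (enum 'I_n)) F w.
Proof.
move=> sb; rewrite -big_filter -(big_map perm_word predT F).
have sE := sorted_enum_ord.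
apply: perm_big; apply: uniq_perm; rewrite ?split_words_uniq //.
  by rewrite map_inj_uniq ?filter_uniq ?index_enum_uniq //; apply: perm_word_inj.
move=> w; rewrite mem_split_words ?size_enum_ord //.
apply/mapP/andP => [[s]|[/perm_wordP[s e] a]].
  rewrite mem_filter => /andP[ss _] ->; rewrite -shuffle_sorted //; split=> //.
  by apply/perm_wordP; exists s.
by exists s => //; rewrite mem_filter mem_index_enum shuffle_sorted // -e a.
Qed.

Lemma big_shuffle2 (U : nmodType) (i : nat) (F : seq 'I_n -> U) : (i <= n)%N ->
  \sum_(s : 'S_n | shuffle [:: i; n - i]%N s) F (perm_word s) =
  \sum_(p <- splits (enum 'I_n) | size p.1 == i) F (p.1 ++ p.2).
Proof.
move=> iN; rewrite big_shuffle; last by rewrite /= addn0 subnKC.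
rewrite big_split_words big_seq_cond [RHS]big_seq_cond.
apply: eq_bigr => p /andP[/splits_perm/perm_size]; rewrite size_cat size_enum_ord => sp /eqP pi.
have -> : (n - i = size p.2)%N by apply: (@addnI (size p.1)); rewrite sp pi subnKC.
(* The last block takes all the letters that are left, so its splitting has a single term. *)
by rewrite big_split_words big_splits_full big_seq1 cats0.
Qed.

Lemma big_shuffle3 (U : nmodType) (j i : nat) (F : seq 'I_n -> U) : (i + j <= n)%N ->
  \sum_(s : 'S_n | shuffle [:: j; i; n - j - i]%N s) F (perm_word s) =
  \sum_(p <- splits (enum 'I_n) | size p.1 == j)
    \sum_(q <- splits p.2 | size q.1 == i) F (p.1 ++ q.1 ++ q.2).
Proof.
move=> ijn; rewrite big_shuffle; last first.
  by rewrite /= addn0 -subnDA -[RHS](subnKC ijn) addnA [(i + j)%N]addnC.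
rewrite big_split_words big_seq_cond [RHS]big_seq_cond.
apply: eq_bigr => p /andP[/splits_perm/perm_size]; rewrite size_cat size_enum_ord => sp /eqP pj.
rewrite big_split_words big_seq_cond [RHS]big_seq_cond.
apply: eq_bigr => q /andP[/splits_perm/perm_size]; rewrite size_cat => sq /eqP qi.
have nj : (n - j = size p.2)%N.
  by apply: (@addnI (size p.1)); rewrite sp pj subnKC // (leq_trans (leq_addl i j)).
have -> : (n - j - i = size q.2)%N by rewrite nj -sq qi addKn.
by rewrite big_split_words big_splits_full big_seq1 cats0.
Qed.

End Shuffles.

(** Used with [f] the size of a block, to absorb the sums over block sizes into one sum over
    splittings. *)
Lemma big_fiber_nat (U : nmodType) (T : Type) (r : seq T) (f : T -> nat) (G : T -> U) a b :
  \sum_(a <= i < b) \sum_(p <- r | f p == i) G p = \sum_(p <- r | (a <= f p < b)%N) G p.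
Proof.
under eq_bigr do rewrite big_mkcond.
rewrite exchange_big [RHS]big_mkcond /=; apply: eq_bigr => p _.
rewrite -mem_index_iota; case: ifP => [fp|/negbT fp].
  rewrite (bigD1_seq (f p)) ?iota_uniq //= eqxx big1 ?addr0 // => i /negbTE.
  by rewrite eq_sym => ->.
rewrite big_seq big1 // => i; case: eqP => // <- ir.
by rewrite ir in fp.
Qed.

(** * Koszul signs when words are substituted for letters *)

Section WordSubstitution.
Variables (disp disp' : Order.disp_t) (I : orderType disp) (L : orderType disp').
Variables (K : fieldType) (d : I -> int) (D : L -> int).
Implicit Types (p q : seq I).

Lemma wsign_sorted p : sorted <%O p -> wsign K d p = 1.
Proof.
elim: p => //= x p IH s; have/allP xp := order_path_min lt_trans s.
rewrite wsign_cons (IH (path_sorted s)) mulr1 big_seq_cond big_pred0.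
  by case: ifP => // /xp; rewrite ltxx.
by move=> y; apply/andP => -[/xp/ltW]; rewrite leNgt => /negP.
Qed.

(** Exchanging two neighbouring indices multiplies both factors by the same sign, because [f i] has
    the degree of [i]; the square of that sign is 1. *)
Lemma wsign_subst (f : I -> seq L) p q w1 w2 :
  (forall i, wdeg D (f i) = d i) -> perm_eq p q ->
  wsign K d p * wsign K D (w1 ++ flatten (map f p) ++ w2) =
  wsign K d q * wsign K D (w1 ++ flatten (map f q) ++ w2).
Proof.
move=> fd; move: p q; apply: perm_swap_invariant => u x y v.
rewrite wsign_swap2 !map_cat !flatten_cat /= -!catA [w1 ++ _ ++ _]catA wsign_swap !fd.
by rewrite mulrACA signz_sqr mul1r -!catA.
Qed.

Lemma wsign_map (f : I -> L) p : sorted <%O p -> uniq (map f p) ->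
  wsign K D (map f p) =
  \prod_(i <- p) \prod_(j <- p | (i < j)%O && (f j < f i)%O) (-1) ^ (D (f i) * D (f j)).
Proof.
elim: p => [|x p IH] /=; first by rewrite big_nil.
rewrite wsign_cons => s /andP[/negbTE-> u]; have/allP xp := order_path_min lt_trans s.
rewrite (IH (path_sorted s) u) big_cons; congr (_ * _).
  rewrite big_cons ltxx /= big_map big_seq_cond [RHS]big_seq_cond; apply: eq_bigl => i.
  by case: (boolP (i \in p)) => // /xp ->.
apply: eq_big_seq => i /xp xi; rewrite big_cons.
by rewrite ltNge (ltW xi).
Qed.

End WordSubstitution.

Lemma koszul_wsign (K : fieldType) n (d : 'I_n -> int) (s : 'S_n) :
  koszul K d s = wsign K d (perm_word s).
Proof.
rewrite wsign_map ?sorted_enum_ord //; last by rewrite map_inj_uniq ?enum_uniq //; apply: perm_inj.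
rewrite big_enum; apply: eq_bigr => i _; rewrite big_enum_cond.
by apply: eq_bigl => j; rewrite !ltEord.
Qed.

(** The Koszul sign of a permutation is absorbed by writing the letters in permuted order. This
    turns identities with signs into sign-free sums over words. *)
Lemma koszul_subst disp (L : orderType disp) (K : fieldType) (D : L -> int) n
    (f : 'I_n -> seq L) (s : 'S_n) w1 w2 :
  koszul K (fun i => wdeg D (f i)) s * wsign K D (w1 ++ flatten (map f (enum 'I_n)) ++ w2) =
  wsign K D (w1 ++ flatten (map f (perm_word s)) ++ w2).
Proof.
have ps : perm_eq (perm_word s) (enum 'I_n) by apply/perm_wordP; exists s.
have := @wsign_subst _ _ _ _ K (fun i => wdeg D (f i)) D f _ _ w1 w2 (fun=> erefl) ps.
rewrite (wsign_sorted _ _ (sorted_enum_ord n)) mul1r => <-.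
by rewrite koszul_wsign mulrA wsign_sq ?mul1r // (perm_uniq ps) enum_uniq.
Qed.

(** * Graded structures on words *)

Section Words.
Variables (disp : Order.disp_t) (L : orderType disp) (K : fieldType) (D : L -> int).
Variable (V : gradedType K).

(* An element of [V] paired with the word of the letters it is made of: the
   pair [(w, v)] stands for [theta_w v], where the letters [theta_x] are formal
   graded commuting variables of degree [- D x]. *)
Implicit Types (g : seq L * V) (gs : seq (seq L * V)).

Definition dhomog g := hcomp (wdeg D g.1) g.2 == g.2.

Definition dword gs : seq L := flatten [seq g.1 | g <- gs].

Definition dvals gs : seq V := [seq g.2 | g <- gs].

Lemma dword_cat gs gs' : dword (gs ++ gs') = dword gs ++ dword gs'.
Proof. by rewrite /dword map_cat flatten_cat. Qed.

Lemma dword_cons g gs : dword (g :: gs) = g.1 ++ dword gs.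
Proof. by []. Qed.

Lemma dvals_cat gs gs' : dvals (gs ++ gs') = dvals gs ++ dvals gs'.
Proof. exact: map_cat. Qed.

Lemma dword_rcons g gs : dword (rcons gs g) = dword gs ++ g.1.
Proof. by rewrite -cats1 dword_cat /dword /= cats0. Qed.

Lemma dvals_rcons g gs : dvals (rcons gs g) = rcons (dvals gs) g.2.
Proof. exact: map_rcons. Qed.

(** Exchanging two neighbouring arguments changes the value and the sign of the word alike, so their
    product does not change. *)
Lemma graded_symmetric_perm (W : gradedType K) (f : seq V -> W) gs gs' w1 w2 :
  graded_symmetric f -> all dhomog gs -> perm_eq gs gs' ->
  wsign K D (w1 ++ dword gs ++ w2) *: f (dvals gs) =
  wsign K D (w1 ++ dword gs' ++ w2) *: f (dvals gs').
Proof.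
move=> fs hgs p; have hgs' : all dhomog gs' by rewrite -(perm_all _ p).
pose F gs := if all dhomog gs then wsign K D (w1 ++ dword gs ++ w2) *: f (dvals gs) else 0.
suff : F gs = F gs' by rewrite /F hgs hgs'.
apply: perm_swap_invariant p => u x y v; rewrite /F !all_cat /=.
case: (boolP (dhomog x)) => [/eqP hx|_]; last by rewrite /= !andbF.
case: (boolP (dhomog y)) => [/eqP hy|_]; last by rewrite /= !andbF.
rewrite /=; case: ifP => // _; rewrite !dword_cat !dvals_cat !dword_cons /=.
rewrite (fs _ _ _ _ _ _ hx hy) -!catA [w1 ++ _ ++ _]catA wsign_swap scalerA mulrAC.
by rewrite signz_sqr mul1r -!catA.
Qed.

End Words.

Arguments dhomog {disp L K} D {V} g.

Section LinftyWords.
Variables (disp : Order.disp_t) (L : orderType disp) (K : fieldType) (D : L -> int).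
Variables (V : gradedType K) (l : seq V -> V).
Hypothesis hl : Linfty_algebra l.

Lemma Linfty_words (gs : seq (seq L * V)) w1 w2 : all (dhomog D) gs -> (0 < size gs)%N ->
  \sum_(p <- splits gs | (0 < size p.1)%N)
     wsign K D (w1 ++ dword p.1 ++ dword p.2 ++ w2) *: l (l (dvals p.1) :: dvals p.2) = 0.
Proof.
move=> hgs n0; set n := size gs in n0; pose g0 : seq L * V := ([::], 0).
pose g (i : 'I_n) := nth g0 gs i.
have gsE : gs = map g (enum 'I_n).
  by rewrite (map_comp (nth g0 gs) val) val_enum_ord map_nth_iota0 // take_size.
pose d i := wdeg D (g i).1.
have hd i : homogeneous (d i) (g i).2 by apply/eqP/(allP hgs)/mem_nth.
have /(congr1 (GRing.scale (wsign K D (w1 ++ dword gs ++ w2)))) := Linfty_identity hl n0 hd.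
rewrite scaler0 scaler_sumr => H; rewrite -[RHS]H {H}.
pose F i (w : seq 'I_n) := wsign K D (w1 ++ flatten (map (fst \o g) w) ++ w2) *:
  l (l (take i (map (snd \o g) w)) :: drop i (map (snd \o g) w)).
transitivity (\sum_(1 <= i < n.+1)
    \sum_(p <- splits (enum 'I_n) | size p.1 == i) F (size p.1) (p.1 ++ p.2)).
  rewrite big_fiber_nat [in LHS]gsE splits_map big_map big_seq_cond [RHS]big_seq_cond.
  apply: eq_big => [p|p /andP[_ _]].
    case: (boolP (p \in _)) => //= /splits_perm/perm_size.
    rewrite size_cat size_enum_ord size_map ltnS => sp.
    by have := leq_addr (size p.2) (size p.1); rewrite sp => ->; rewrite andbT.
  rewrite /F !map_cat flatten_cat take_size_cat ?size_map // drop_size_cat ?size_map //.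
  by rewrite /dword /dvals /= -!map_comp -!catA.
apply: eq_big_nat => i /andP[i0 iN].
(* With the block size fixed to [i], the summand depends only on the concatenated word, as the
   passage to shuffles requires. *)
rewrite (eq_bigr (fun p => F i (p.1 ++ p.2))) => [|p /eqP-> //].
rewrite -big_shuffle2 // scaler_sumr; apply: eq_bigr => s _.
rewrite scalerA /= /F mulrC gsE /dword -map_comp koszul_subst; congr (_ *: _).
by rewrite /args /perm_word -!map_comp.
Qed.

End LinftyWords.

Section LinearMap.
Variables (K : fieldType) (U V : lmodType K) (f : U -> V).
Hypothesis fl : linear f.

Lemma lin0 : f 0 = 0.
Proof. by have := fl (-1) 0 0; rewrite scaler0 add0r scaleN1r addNr. Qed.

Lemma linZ c x : f (c *: x) = c *: f x.
Proof. by have := fl c x 0; rewrite !addr0 lin0 addr0. Qed.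

Lemma linD x y : f (x + y) = f x + f y.
Proof. by have := fl 1 x y; rewrite !scale1r. Qed.

Lemma lin_sum (I : Type) (r : seq I) (P : pred I) (F : I -> U) :
  f (\sum_(i <- r | P i) F i) = \sum_(i <- r | P i) f (F i).
Proof. exact: (big_morph f linD lin0). Qed.

End LinearMap.

Lemma homogeneous0 (K : fieldType) (V : gradedType K) i : homogeneous i (0 : V).
Proof. exact: linear0. Qed.

Lemma homogeneousZ (K : fieldType) (V : gradedType K) i c (x : V) :
  homogeneous i x -> homogeneous i (c *: x).
Proof. by rewrite /homogeneous linearZ /= => ->. Qed.

Lemma homogeneousD (K : fieldType) (V : gradedType K) i (x y : V) :
  homogeneous i x -> homogeneous i y -> homogeneous i (x + y).
Proof. by rewrite /homogeneous linearD /= => -> ->. Qed.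

(** * Graded commutative products and the Leibniz rule on words *)

Section GradedProduct.
Variables (K : fieldType) (A : gradedType K) (mul : A -> A -> A).
Hypothesis hmul : graded_comm_algebra mul.
Implicit Types (x y : A) (s t : seq A).

Lemma foldl_mul_linear t : linear (fun x => foldl mul x t).
Proof. by elim: t => //= y t IH c x x'; rewrite gmul_linearl // IH. Qed.

Lemma mulseq_cons x s : (0 < size s)%N -> mulseq mul (x :: s) = mul x (mulseq mul s).
Proof. by case: s => //= y s _; elim: s y => //= z s IH y; rewrite -(gmulA hmul) IH. Qed.

Lemma mulseq_cat s t : (0 < size s)%N -> (0 < size t)%N ->
  mulseq mul (s ++ t) = mul (mulseq mul s) (mulseq mul t).
Proof.
elim: s => // x s IH _ t0; case: (posnP (size s)) => [/size0nil->|s0] /=.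
  exact: mulseq_cons.
rewrite -/(mulseq mul (x :: s ++ t)) mulseq_cons ?size_cat ?addn_gt0 ?s0 // IH //.
by rewrite -/(mulseq mul (x :: s)) mulseq_cons // (gmulA hmul).
Qed.

Lemma mulseq_catl s t : (0 < size s)%N -> mulseq mul (mulseq mul s :: t) = mulseq mul (s ++ t).
Proof. by case: s => // x s _; rewrite /= foldl_cat. Qed.

Lemma mulseq_catr s t : (0 < size t)%N -> mulseq mul (rcons s (mulseq mul t)) = mulseq mul (s ++ t).
Proof.
move=> t0; case: (posnP (size s)) => [/size0nil->//|s0].
by rewrite -cats1 !mulseq_cat.
Qed.

Lemma mulseq_multilinear : multilinear (mulseq mul).
Proof.
move=> c x y [|a s] t /=; first exact: foldl_mul_linear.
by rewrite !foldl_cat /= gmul_linearr // foldl_mul_linear.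
Qed.

Lemma mulseq_symmetric : graded_symmetric (mulseq mul).
Proof.
move=> i j x y s t hx hy.
case: s => [|a s] /=; first by rewrite (gmulC hmul hx hy) (linZ (foldl_mul_linear t)).
rewrite !foldl_cat /= -!(gmulA hmul) (gmulC hmul hx hy).
by rewrite (linZ (gmul_linearr hmul _)) (linZ (foldl_mul_linear t)).
Qed.

End GradedProduct.

Section WordOps.
Variables (disp : Order.disp_t) (L : orderType disp) (K : fieldType) (D : L -> int).
Variables (A : gradedType K) (mul : A -> A -> A) (l : seq A -> A).
Hypothesis hA : homotopy_Poisson_algebra mul l.
Local Notation dec := (seq L * A)%type.
Local Notation wsign := (wsign K D).
Implicit Types (g : dec) (gs : seq dec) (c : L).

Let hmul := hPoisson_comm_algebra hA.
Let hl := hPoisson_Linfty hA.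

(** The degree 1 letter [c] stands for [l] itself, so that the degree of the word agrees with that
    of the value. *)
Definition dop c gs : dec := (c :: dword gs, l (dvals gs)).
Definition dmul gs : dec := (dword gs, mulseq mul (dvals gs)).

Lemma dvals_args gs : all (dhomog D) gs ->
  exists (x : 'I_(size gs) -> A) (d : 'I_(size gs) -> int),
    [/\ dvals gs = args x, forall i, homogeneous (d i) (x i) & wdeg D (dword gs) = \sum_i d i].
Proof.
move=> hgs; pose g0 : dec := ([::], 0); pose g (i : 'I_(size gs)) := nth g0 gs i.
exists (fun i => (g i).2), (fun i => wdeg D (g i).1); split.
- rewrite -[in LHS](mkseq_nth g0 gs) /mkseq -val_enum_ord /dvals /args -!map_comp.
  exact: eq_map.
- by move=> i; apply/eqP/(allP hgs)/mem_nth.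
by rewrite /wdeg /dword big_flatten big_map (big_nth g0) big_mkord.
Qed.

Lemma dhomog_op c gs : D c = 1 -> all (dhomog D) gs -> (0 < size gs)%N -> dhomog D (dop c gs).
Proof.
move=> c1 hgs n0; have [x [d [e hx hd]]] := dvals_args hgs.
apply/eqP; rewrite /= wdeg_cons c1 hd e; exact: (Linfty_degree hl).
Qed.

Lemma dhomog_mul gs : all (dhomog D) gs -> dhomog D (dmul gs).
Proof.
elim: gs => [|g gs IH] /=; first by rewrite /dhomog linear0.
case/andP=> hg hgs; case: (posnP (size gs)) => [/size0nil->|n0].
  by rewrite /dhomog /dmul dword_cons cats0.
have := IH hgs; rewrite /dhomog /dmul dword_cons wdeg_cat => /eqP hm; apply/eqP.
rewrite [(_, _).2]mulseq_cons ?size_map //.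
exact: gmul_degree (eqP hg) hm.
Qed.

Lemma leibniz gs g z : all (dhomog D) gs -> dhomog D g ->
  l (rcons (dvals gs) (mul g.2 z)) =
    mul (l (rcons (dvals gs) g.2)) z
    + (-1) ^ (wdeg D g.1 * (1 + wdeg D (dword gs))) *: mul g.2 (l (rcons (dvals gs) z)).
Proof.
move=> hgs /eqP hg; have [x [d [-> hx ->]]] := dvals_args hgs.
exact: hPoisson_leibniz hA _ _ _ _ _ _ hx hg.
Qed.

(** The sign in the Leibniz rule is that of carrying a factor across [l] and its earlier arguments;
    in the word its letters make the same move. Graded commutativity then brings the factor hit by
    [l] to the front, which gives all terms one shape. *)
Lemma leibniz_mulseq c xs ys w1 w2 : D c = 1 ->
    all (dhomog D) xs -> all (dhomog D) ys -> (0 < size ys)%N ->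
  wsign (w1 ++ (dop c (rcons xs (dmul ys))).1 ++ w2) *: (dop c (rcons xs (dmul ys))).2 =
  \sum_(p <- picks ys)
     wsign (w1 ++ (dmul (dop c (rcons xs p.1) :: p.2)).1 ++ w2) *:
       (dmul (dop c (rcons xs p.1) :: p.2)).2.
Proof.
move=> c1 hxs; elim: ys w1 => // y ys IH w1 /= /andP[hy hys] _.
case: (posnP (size ys)) => [/size0nil-> /=|n0].
  by rewrite big_seq1 /dmul /dop /= !dword_rcons !dvals_rcons /dword /= !cats0.
rewrite big_cons big_map -[(y, ys).1]/y -[(y, ys).2]/ys.
have e1 g : (dmul (g :: ys)).2 = mul g.2 (dmul ys).2.
  by rewrite [LHS]mulseq_cons ?size_map.
rewrite /dop !dword_rcons !dvals_rcons !e1 leibniz // scalerDr; congr (_ + _).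
  rewrite /dmul !dword_cons -!catA -[foldl _ _ _]/(mulseq mul (_ :: dvals ys)).
  by rewrite mulseq_cons ?size_map.
rewrite scalerA.
(* The letters of [y] move in front of [c] and [xs]; this uses up the Leibniz sign and lets the
   induction hypothesis apply with prefix [w1 ++ y.1]. *)
transitivity (wsign (w1 ++ y.1 ++ (c :: dword xs) ++ dword ys ++ w2) *:
   mul y.2 (l (rcons (dvals xs) (mulseq mul (dvals ys))))).
  congr (_ *: _); rewrite /dmul dword_cons (@wsign_swap _ _ K D w1 y.1) wdeg_cons c1.
  by rewrite mulrC /= -!catA.
have := IH (w1 ++ y.1) hys n0; rewrite /dop !dword_rcons !dvals_rcons /= -!catA.
have my := gmul_linearr hmul y.2; move=> /(congr1 (mul y.2)).
rewrite (linZ my) (lin_sum my) => ->; apply: eq_big_seq => p /picks_perm pp.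
have /andP[hp hp2] : all (dhomog D) (p.1 :: p.2) by rewrite (perm_all _ pp).
have ho : dhomog D (dop c (rcons xs p.1)).
  by apply: dhomog_op; rewrite ?size_rcons // all_rcons hp.
rewrite (linZ my) -[foldl mul (l _) _]/(mulseq mul (l _ :: dvals p.2)) -(mulseq_cons hmul) //.
have pe : perm_eq [:: y, dop c (rcons xs p.1) & p.2] [:: dop c (rcons xs p.1), y & p.2].
  by apply/seq.permP => P /=; rewrite addnCA.
have hg : all (dhomog D) [:: y, dop c (rcons xs p.1) & p.2] by apply/and3P.
have := graded_symmetric_perm w1 w2 (mulseq_symmetric hmul) hg pe; rewrite /dword /= -!catA /= -!catA; exact.
Qed.

End WordOps.

(** * Multilinear extension from pure tensors *)

Section ComponentSum.
Variables (K : fieldType) (V : gradedType K) (U : lmodType K) (G : int -> V -> U).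
Hypothesis Gl : forall d, linear (G d).

(** Makes a recipe that depends on the degree, such as a sign, into one linear map on inhomogeneous
    elements. *)
Definition comp_sum (x : V) : U := \sum_(d <- gsupp x) G d (hcomp d x).

Lemma comp_sum_supp x (s : seq int) :
  uniq s -> (forall d, d \notin s -> hcomp d x = 0) ->
  comp_sum x = \sum_(d <- s) G d (hcomp d x).
Proof.
move=> us hs; apply: sum_gsupp => // d; first by move=> /hs ->; rewrite lin0.
by move=> ->; rewrite lin0.
Qed.

Lemma comp_sum_linear : linear comp_sum.
Proof.
move=> c x y; set s := undup (gsupp x ++ gsupp y).
have us : uniq s by apply: undup_uniq.
have hx d : d \notin s -> hcomp d x = 0.
  rewrite mem_undup mem_cat negb_or => /andP[h _]; exact: hcomp_out (gsupp_sum x) h.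
have hy d : d \notin s -> hcomp d y = 0.
  rewrite mem_undup mem_cat negb_or => /andP[_ h]; exact: hcomp_out (gsupp_sum y) h.
have hxy d : d \notin s -> hcomp d (c *: x + y) = 0.
  by move=> h; rewrite linearP /= hx ?hy // scaler0 addr0.
rewrite !(comp_sum_supp us) // scaler_sumr -big_split /=.
by apply: eq_bigr => d _; rewrite linearP /= Gl.
Qed.

Lemma comp_sum_homogeneous d x : homogeneous d x -> comp_sum x = G d x.
Proof.
move=> hx; rewrite (@comp_sum_supp _ [:: d]) ?big_seq1 ?hx // => i.
by rewrite inE (hcomp_homogeneous _ hx) => /negbTE->.
Qed.

End ComponentSum.

Section TensorLift.
Variables (K : fieldType) (A B U : lmodType K).
Implicit Types f : A -> B -> U.

Lemma tlift_comb c f f1 f2 z :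
  (forall b, linear (f1^~ b)) -> (forall a, linear (f1 a)) ->
  (forall b, linear (f2^~ b)) -> (forall a, linear (f2 a)) ->
  (forall a b, f a b = c *: f1 a b + f2 a b) ->
  tlift f z = c *: tlift f1 z + tlift f2 z.
Proof.
move=> l1 r1 l2 r2 e.
have l3 b : linear (f^~ b).
  move=> k a a'; rewrite !e l1 l2 !scalerDr !scalerA [k * c]mulrC; exact: addrACA.
have r3 a : linear (f a).
  move=> k b b'; rewrite !e r1 r2 !scalerDr !scalerA [k * c]mulrC; exact: addrACA.
elim/tensor_ind: z => [|k a b z IH]; first by rewrite !(lin0 (tlift_is_linear _ _)) // scaler0 addr0.
rewrite !tlift_is_linear // !tlift_tens // IH e !scalerDr !scalerA [k * c]mulrC.
exact: addrACA.
Qed.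

Lemma tlift_scale c f f1 z :
  (forall b, linear (f1^~ b)) -> (forall a, linear (f1 a)) ->
  (forall a b, f a b = c *: f1 a b) -> tlift f z = c *: tlift f1 z.
Proof.
(* Writing [c] as [(c - 1) + 1] makes a multiple of [f1] a combination of the form treated
   before. *)
move=> l1 r1 e; rewrite (@tlift_comb (c - 1) f f1 f1) //.
  by rewrite -[X in _ + X]scale1r -scalerDl subrK.
by move=> a b; rewrite -[X in _ + X]scale1r -scalerDl subrK.
Qed.

End TensorLift.

Lemma homogeneous_tensor_decomposition (K : fieldType) (A B : gradedType K) (z : tensor A B) n :
  homogeneous n z -> exists r : seq (int * int * (A * B)),
    (forall p, p \in r -> [/\ p.1.1 + p.1.2 = n, homogeneous p.1.1 p.2.1 & homogeneous p.1.2 p.2.2])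
    /\ z = \sum_(p <- r) p.2.1 ⊗ p.2.2.
Proof.
(* Replacing [z] by its component of degree [n] frees the induction from homogeneity, which its
   summands need not have. *)
move=> <-; elim/tensor_ind: z => [|c a b z [r [hr e]]].
  by exists [::]; rewrite big_nil linear0.
exists ([seq (i, n - i, (c *: hcomp i a, hcomp (n - i) b)) | i <- gsupp a] ++ r); split.
  move=> p; rewrite mem_cat => /orP[/mapP[i _ ->]|/hr //] /=.
  split; [by rewrite addrC subrK | apply: homogeneousZ |]; apply: homogeneous_hcomp.
rewrite big_cat big_map /= -e linearP /= -[hcomp n (_ ⊗ _)]/(thcomp n _) thcomp_tens /thcomp2.
congr (_ + _); rewrite scaler_sumr; apply: eq_bigr => i _.
by rewrite (linZ (tens_linearl _)).
Qed.

Section Extension.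
Variables (K : fieldType) (A U : gradedType K).
Implicit Types (F : seq A -> seq A -> U) (zs : seq (tensor A A)) (e : int).

Definition twist e (a : A) : A := comp_sum (fun d a => (-1) ^ (e * d) *: a) a.

Lemma twist_linear e : linear (twist e).
Proof. by apply: comp_sum_linear => d c x y; rewrite scalerDr !scalerA mulrC. Qed.

Lemma twist_homogeneous e d a : homogeneous d a -> twist e a = (-1) ^ (e * d) *: a.
Proof. by apply: comp_sum_homogeneous => {}d c x y; rewrite scalerDr !scalerA mulrC. Qed.

Definition bimultilinear F := (forall xs, multilinear (F^~ xs)) /\ (forall s, multilinear (F s)).

(* The multilinear extension of
   [(a_1 ⊗ x_1, ..., a_n ⊗ x_n) |-> (-1)^(\sum_i (e + x_1 + ... + x_(i-1)) a_i)
    F (a_1, ..., a_n) (x_1, ..., x_n)] *)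
Fixpoint ext zs F e : U :=
  if zs is z :: zs' then
    tlift (fun a => comp_sum (fun d x =>
      ext zs' (fun s xs => F (twist e a :: s) (x :: xs)) (e + d))) z
  else F [::] [::].

Lemma bimultilinear_cons F a x : bimultilinear F -> bimultilinear (fun s xs => F (a :: s) (x :: xs)).
Proof.
move=> [Fl Fr]; split=> [xs|s] c y z u v; first exact: (Fl _ c y z (a :: u)).
exact: (Fr _ c y z (x :: u)).
Qed.

(** Linearity in the kernel has to come before linearity in the tensors: each step of [ext] lifts a
    map whose bilinearity is the linearity of the remaining extension in its kernel. *)
Lemma ext_comb zs c F F1 F2 e : bimultilinear F1 -> bimultilinear F2 ->
  (forall s xs, F s xs = c *: F1 s xs + F2 s xs) ->
  ext zs F e = c *: ext zs F1 e + ext zs F2 e.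
Proof.
elim: zs c F F1 F2 e => [|z zs IH] c F F1 F2 e b1 b2 eF //=.
have lr F' a d : bimultilinear F' ->
    linear (fun x => ext zs (fun s xs => F' (twist e a :: s) (x :: xs)) (e + d)).
  move=> b' k x y; apply: IH; try exact: bimultilinear_cons.
  by move=> s xs; apply: (b'.2 _ k x y [::]).
have ll F' d x : bimultilinear F' ->
    linear (fun a => ext zs (fun s xs => F' (twist e a :: s) (x :: xs)) (e + d)).
  move=> b' k a a'; apply: IH; try exact: bimultilinear_cons.
  by move=> s xs; rewrite twist_linear; apply: (b'.1 _ k _ _ [::]).
have cr F' a : bimultilinear F' -> linear (comp_sum (fun d x =>
    ext zs (fun s xs => F' (twist e a :: s) (x :: xs)) (e + d))).
  by move=> b'; apply: comp_sum_linear => d; apply: lr.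
have cl F' x : bimultilinear F' -> linear (fun a => comp_sum (fun d x =>
    ext zs (fun s xs => F' (twist e a :: s) (x :: xs)) (e + d)) x).
  move=> b' k a a'; rewrite /comp_sum scaler_sumr -big_split /=.
  by apply: eq_bigr => d _; apply: ll.
apply: tlift_comb => [x|a|x|a|a x]; try exact: cr; try exact: cl.
rewrite /comp_sum scaler_sumr -big_split /=; apply: eq_bigr => d _.
by apply: IH; try exact: bimultilinear_cons.
Qed.

Lemma ext_scale zs c F F1 e : bimultilinear F1 -> (forall s xs, F s xs = c *: F1 s xs) ->
  ext zs F e = c *: ext zs F1 e.
Proof.
move=> b1 eF; rewrite (@ext_comb zs (c - 1) F F1 F1) //.
  by rewrite -[X in _ + X]scale1r -scalerDl subrK.
by move=> s xs; rewrite -[X in _ + X]scale1r -scalerDl subrK.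
Qed.

Section ExtCons.
Variables (F : seq A -> seq A -> U) (zs : seq (tensor A A)) (e : int).
Hypothesis bF : bimultilinear F.

Let step a := comp_sum (fun d x => ext zs (fun s xs => F (twist e a :: s) (x :: xs)) (e + d)).

Lemma ext_step_linearr a : linear (step a).
Proof.
apply: comp_sum_linear => d k x y; apply: ext_comb; try exact: bimultilinear_cons.
by move=> s xs; apply: (bF.2 _ k x y [::]).
Qed.

Lemma ext_step_linearl x : linear (step^~ x).
Proof.
move=> k a a'; rewrite /step /comp_sum scaler_sumr -big_split /=.
apply: eq_bigr => d _; apply: ext_comb; try exact: bimultilinear_cons.
by move=> s xs; rewrite twist_linear; apply: (bF.1 _ k _ _ [::]).
Qed.

Lemma ext_cons_linear : linear (fun z => ext (z :: zs) F e).
Proof. exact: tlift_is_linear ext_step_linearl ext_step_linearr. Qed.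

Lemma ext_cons_tens d a x : homogeneous d x ->
  ext (a ⊗ x :: zs) F e = ext zs (fun s xs => F (twist e a :: s) (x :: xs)) (e + d).
Proof.
move=> hx; rewrite /= (tlift_tens ext_step_linearl ext_step_linearr).
rewrite /step (comp_sum_homogeneous _ hx) // => i k y z.
apply: ext_comb; try exact: bimultilinear_cons.
by move=> s xs; apply: (bF.2 _ k y z [::]).
Qed.

End ExtCons.

Arguments ext : simpl never.

Lemma ext_tens_cons F zs e i d a x : bimultilinear F -> homogeneous i a -> homogeneous d x ->
  ext (a ⊗ x :: zs) F e =
  (-1) ^ (e * i) *: ext zs (fun s xs => F (a :: s) (x :: xs)) (e + d).
Proof.
move=> bF ha hx; rewrite (ext_cons_tens _ _ _ _ hx) // (twist_homogeneous _ ha).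
apply: ext_scale; first exact: bimultilinear_cons.
by move=> s xs; apply: (linZ (f := fun a => F (a :: s) (x :: xs))) => k y z; apply: (bF.1 _ k y z [::]).
Qed.

Lemma ext_multilinear F e : bimultilinear F -> multilinear (fun zs => ext zs F e).
Proof.
move=> bF c y z s t; elim: s F e bF => [|z0 s IH] F e bF.
  exact: (ext_cons_linear t e bF).
apply: tlift_comb; try by move=> ?; first [exact: ext_step_linearl | exact: ext_step_linearr].
move=> a x; rewrite /comp_sum scaler_sumr -big_split /=; apply: eq_bigr => d _.
by apply: IH; apply: bimultilinear_cons.
Qed.

Definition bisymmetric F :=
  (forall xs, graded_symmetric (F^~ xs)) /\ (forall s, graded_symmetric (F s)).

(** The exchange sign of two tensors has four factors. The symmetry of [F] in each argument accounts
    for those of two first or two second components, the twists for the two mixed ones. *)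
Lemma ext_symmetric F e : bimultilinear F -> bisymmetric F ->
  graded_symmetric (fun zs => ext zs F e).
Proof.
move=> bF sF i j y z s t hy hz; elim: s F e bF sF => [|z0 s IH] F e bF sF; last first.
  apply: tlift_scale; try by move=> ?; first [exact: ext_step_linearl | exact: ext_step_linearr].
  move=> a x; rewrite /comp_sum scaler_sumr; apply: eq_bigr => d _.
  apply: IH; first exact: bimultilinear_cons.
  split=> [xs|u] i' j' a1 a2 u' v hi hj; first exact: (sF.1 _ _ _ _ _ (_ :: u') v hi hj).
  exact: (sF.2 _ _ _ _ _ (_ :: u') v hi hj).
have [r [hr ->]] := homogeneous_tensor_decomposition hy.
have [q [hq ->]] := homogeneous_tensor_decomposition hz.
have e1 w : linear (fun u => ext (u :: w :: t) F e) by apply: ext_cons_linear.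
have e2 w : linear (fun u => ext (w :: u :: t) F e).
  by move=> c u v; apply: (ext_multilinear e bF c u v [:: w]).
rewrite /= (lin_sum (e1 _)) (lin_sum (e2 _)) scaler_sumr big_seq [RHS]big_seq.
apply: eq_bigr => -[[da dx] [a x]] /hr[/= dr ha hx].
rewrite (lin_sum (e1 _)) (lin_sum (e2 _)) scaler_sumr big_seq [RHS]big_seq.
apply: eq_bigr => -[[db dy] [b x']] /hq[/= dq hb hx'].
have b1 a' x'' : bimultilinear (fun s xs => F (a' :: s) (x'' :: xs)) by apply: bimultilinear_cons.
rewrite (ext_tens_cons _ _ bF ha hx) (ext_tens_cons _ _ (b1 _ _) hb hx').
rewrite (ext_tens_cons _ _ bF hb hx') (ext_tens_cons _ _ (b1 _ _) ha hx).
rewrite addrAC (@ext_scale t ((-1) ^ (da * db) * (-1) ^ (dx * dy)) _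
  (fun s xs => F [:: b, a & s] [:: x', x & xs])); last first.
- move=> s xs; rewrite (sF.1 _ _ _ _ _ [::] s ha hb) (sF.2 _ _ _ _ _ [::] xs hx hx') /=.
  by rewrite scalerA.
- exact: (bimultilinear_cons a x (b1 b x')).
(* The twists differ by [dx * db] on one side and [dy * da] on the other, the mixed terms of
   [(da + dx) * (db + dy)]. *)
rewrite !scalerA; congr (_ *: _); rewrite -dr -dq !mulrDl !mulrDr !signzD.
rewrite [dy * da]mulrC; case: (signzP K (da * dy)) => ->; ring.
Qed.

Lemma ext_degree F e k n (hs : 'I_n -> int) (zs : 'I_n -> tensor A A) : bimultilinear F ->
  (forall (a x : 'I_n -> A) (da dx : 'I_n -> int),
     (forall i, homogeneous (da i) (a i)) -> (forall i, homogeneous (dx i) (x i)) ->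
     homogeneous (k + (\sum_i da i + \sum_i dx i)) (F (args a) (args x))) ->
  (forall i, homogeneous (hs i) (zs i)) ->
  homogeneous (k + \sum_i hs i) (ext (args zs) F e).
Proof.
have argsS (T : Type) m (f : 'I_m.+1 -> T) : args f = f ord0 :: args (fun i => f (lift ord0 i)).
  by rewrite /args enum_ordSl /= -map_comp.
elim: n hs zs F e k => [|n IH] hs zs F e k bF dF hz.
  have := dF (fun=> 0) (fun=> 0) (fun=> 0) (fun=> 0); rewrite /args enum_ord0 !big_ord0 /=.
  by rewrite addr0; apply=> -[].
rewrite argsS big_ord_recl addrA.
have [r [hr ->]] := homogeneous_tensor_decomposition (hz ord0).
rewrite (lin_sum (ext_cons_linear _ e bF)) [X in homogeneous _ X]big_seq.
apply: (big_ind (homogeneous _)); [exact: homogeneous0 | exact: homogeneousD |].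
move=> -[[da dx] [a x]] /hr[/= dr ha hx].
rewrite (ext_tens_cons _ _ bF ha hx); apply/homogeneousZ/IH; first exact: bimultilinear_cons.
  move=> a' x' da' dx' ha' hx'.
  (* The hypothesis on [F] concerns families indexed by ordinals, so prepending an entry needs a
     family on ['I_n.+1]. *)
  pose cons' (T : Type) (y : T) (f : 'I_n -> T) i := oapp f y (unlift ord0 i).
  have c0 T y f : @cons' T y f ord0 = y by rewrite /cons' unlift_none.
  have cS T y f i : @cons' T y f (lift ord0 i) = f i by rewrite /cons' liftK.
  have := dF (cons' _ a a') (cons' _ x x') (cons' _ da da') (cons' _ dx dx').
  rewrite !argsS !c0 !big_ord_recl !c0.
  rewrite (eq_bigr _ (fun i _ => cS _ da da' i)) (eq_bigr _ (fun i _ => cS _ dx dx' i)).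
  have eA (T : Type) y f : args (fun i => @cons' T y f (lift ord0 i)) = args f.
    by apply: eq_map => i; rewrite cS.
  rewrite !eA -dr addrACA !addrA; apply=> i.
    by case: (unliftP ord0 i) => [j ->|->]; rewrite ?c0 ?cS.
  by case: (unliftP ord0 i) => [j ->|->]; rewrite ?c0 ?cS.
by move=> i; apply: hz.
Qed.

Lemma ext_args n (a x : 'I_n -> A) (da dx : 'I_n -> int) F e : bimultilinear F ->
  (forall i, homogeneous (da i) (a i)) -> (forall i, homogeneous (dx i) (x i)) ->
  ext (args (fun i => a i ⊗ x i)) F e =
  (-1) ^ (\sum_(i < n) (e + \sum_(j < n | (j < i)%N) dx j) * da i) *: F (args a) (args x).
Proof.
have argsS (T : Type) m (f : 'I_m.+1 -> T) : args f = f ord0 :: args (fun i => f (lift ord0 i)).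
  by rewrite /args enum_ordSl /= -map_comp.
elim: n a x da dx F e => [|n IH] a x da dx F e bF ha hx.
  by rewrite /args enum_ord0 big_ord0 expr0z scale1r.
rewrite !argsS (ext_tens_cons _ _ bF (ha _) (hx _)) (IH _ _ (da \o lift ord0) (dx \o lift ord0)).
- rewrite scalerA -signzD big_ord_recl.
  have -> : \sum_(j < n.+1 | (j < @ord0 n)%N) dx j = 0 by rewrite big_pred0.
  rewrite addr0; congr ((-1) ^ (_ + _) *: _).
  apply: eq_bigr => i _; rewrite [in RHS]big_mkcond [in RHS]big_ord_recl /= -addrA; congr ((_ + (_ + _)) * _).
  by rewrite big_mkcond.
- exact: bimultilinear_cons.
- by move=> i; apply: ha.
- by move=> i; apply: hx.
Qed.

End Extension.

Arguments ext : simpl never.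

(** * The operations on tensors of words *)

Section Operations.
Variables (K : fieldType) (A : gradedType K) (mul : A -> A -> A) (l : seq A -> A).
Hypothesis hA : homotopy_Poisson_algebra mul l.
Local Notation T := (tensor A A).

Let hmul := hPoisson_comm_algebra hA.
Let hl := hPoisson_Linfty hA.

Lemma mulseq_rcons_linear s : linear (fun a => mulseq mul (rcons s a)).
Proof. by move=> c x y; rewrite -!cats1; apply: (mulseq_multilinear hmul). Qed.

Lemma l_rcons_linear s : linear (fun a => l (rcons s a)).
Proof. by move=> c x y; rewrite -!cats1; apply: (Linfty_multilinear hl). Qed.

Definition bracket_kernel (s xs : seq A) : T := mulseq mul s ⊗ l xs.

(** The last tensor contributes nothing to the sign of $M_{p,1}$, so it is a parameter lifted
    separately and not an entry of [ext]. *)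
Definition action_kernel (z : T) (s xs : seq A) : T :=
  tlift (fun a x : A => mulseq mul (rcons s (l (rcons xs a))) ⊗ x) z.

Lemma action_kernel_linearl s xs x :
  linear (fun a => mulseq mul (rcons s (l (rcons xs a))) ⊗ (x : A)).
Proof. by move=> c a a'; rewrite l_rcons_linear mulseq_rcons_linear tens_linearl. Qed.

Lemma action_kernel_linearr s xs a :
  linear (fun x : A => mulseq mul (rcons s (l (rcons xs a))) ⊗ x).
Proof. exact: tens_linearr. Qed.

Lemma action_kernel_tens a x s xs :
  action_kernel (a ⊗ x) s xs = mulseq mul (rcons s (l (rcons xs a))) ⊗ x.
Proof. exact: (tlift_tens (action_kernel_linearl s xs) (action_kernel_linearr s xs)). Qed.

Lemma bracket_kernel_bimultilinear : bimultilinear bracket_kernel.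
Proof.
split=> [xs|s] c x y u v; rewrite /bracket_kernel.
  by rewrite mulseq_multilinear // tens_linearl.
by rewrite (Linfty_multilinear hl) tens_linearr.
Qed.

Lemma action_kernel_bimultilinear z : bimultilinear (action_kernel z).
Proof.
split=> [xs|s] c x y u v; (apply: tlift_comb => [?|?|?|?|a x'];
  try exact: action_kernel_linearl; try exact: action_kernel_linearr).
  by rewrite !rcons_cat /= mulseq_multilinear // tens_linearl.
by rewrite !rcons_cat /= (Linfty_multilinear hl) mulseq_rcons_linear tens_linearl.
Qed.

Lemma bracket_kernel_symmetric : bisymmetric bracket_kernel.
Proof.
split=> [xs|s] i j x y u v hx hy; rewrite /bracket_kernel.
  by rewrite (mulseq_symmetric hmul _ _ hx hy) (linZ (tens_linearl _)).
by rewrite (Linfty_symmetric hl _ _ hx hy) (linZ (tens_linearr _)).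
Qed.

Lemma action_kernel_symmetric z : bisymmetric (action_kernel z).
Proof.
split=> [xs|s] i j x y u v hx hy; (apply: tlift_scale => [?|?|a x'];
  try exact: action_kernel_linearl; try exact: action_kernel_linearr).
  by rewrite !rcons_cat /= (mulseq_symmetric hmul _ _ hx hy) (linZ (tens_linearl _)).
rewrite !rcons_cat /= (Linfty_symmetric hl _ _ hx hy) (linZ (mulseq_rcons_linear _)).
by rewrite (linZ (tens_linearl _)).
Qed.

Definition lie_bracket (ys : seq T) : T := ext ys bracket_kernel 1.

Definition lie_action (xs : seq T) (y : T) : T := ext xs (action_kernel y) 1.

(* [M_{p,q}] is the sum of the action, for [q = 1], and of the bracket, for [p = 0]. *)
Definition opM (xs ys : seq T) : T :=
  (if size ys == 1%N then lie_action xs (head 0 ys) else 0) +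
  (if nilp xs then lie_bracket ys else 0).

Lemma bracket_multilinear : multilinear lie_bracket.
Proof. exact: ext_multilinear bracket_kernel_bimultilinear. Qed.

Lemma action_multilinear y : multilinear (lie_action^~ y).
Proof. exact: ext_multilinear (action_kernel_bimultilinear y). Qed.

Lemma action_linear xs : linear (lie_action xs).
Proof.
move=> c y z; apply: ext_comb; try exact: action_kernel_bimultilinear.
by move=> s u; apply: tlift_is_linear; [apply: action_kernel_linearl | apply: action_kernel_linearr].
Qed.

Lemma bracket_cons_linear zs : linear (fun z => lie_bracket (z :: zs)).
Proof. by move=> c x y; apply: (bracket_multilinear c x y [::]). Qed.

Lemma action_cons_linear zs y : linear (fun z => lie_action (z :: zs) y).
Proof. by move=> c x x'; apply: (action_multilinear y c x x' [::]). Qed.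

End Operations.

Arguments dword : simpl never.

(** * Normal forms of the operations and the three identities *)

Section TensorWords.
Variables (disp : Order.disp_t) (L : orderType disp) (K : fieldType) (D : L -> int).
Variables (A : gradedType K) (mul : A -> A -> A) (l : seq A -> A).
Hypothesis hA : homotopy_Poisson_algebra mul l.
Local Notation dec := (seq L * A)%type.
Local Notation dten := (dec * dec)%type.
Local Notation wsign := (wsign K D).
Local Notation dop := (dop l).
Local Notation dmul := (dmul mul).
Implicit Types (c : L) (t y : dten) (ts I J : seq dten) (w : seq L).

Let hmul := hPoisson_comm_algebra hA.
Let hl := hPoisson_Linfty hA.

Definition tword t : seq L := t.1.1 ++ t.2.1.
Definition tens_val t : tensor A A := t.1.2 ⊗ t.2.2.
Definition thomog t := dhomog D t.1 && dhomog D t.2.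
Definition twords ts : seq L := flatten (map tword ts).

(** The sign built into [ext] is that of pulling every $a_i$ to the left across [u] and the earlier
    $x_j$. Each step appends the letters of the current $x$ to [u], just as [ext] adds its degree to
    the exponent. *)
Lemma ext_words (U : gradedType K) (F : seq A -> seq A -> U) ts u w1 w2 :
  bimultilinear F -> all thomog ts ->
  wsign (w1 ++ u ++ twords ts ++ w2) *: ext (map tens_val ts) F (wdeg D u) =
  wsign (w1 ++ dword (unzip1 ts) ++ u ++ dword (unzip2 ts) ++ w2) *:
    F (dvals (unzip1 ts)) (dvals (unzip2 ts)).
Proof.
elim: ts F u w1 => [|[a x] ts IH] F u w1 bF //= /andP[/andP[/= /eqP ha /eqP hx] hts].
rewrite -[tens_val (a, x)]/(a.2 ⊗ x.2) (ext_tens_cons _ _ bF ha hx) scalerA -wdeg_cat /twords /= !dword_cons -!catA.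
rewrite wsign_swap mulrAC signz_sqr mul1r.
have := IH _ (u ++ x.1) (w1 ++ a.1) (bimultilinear_cons a.2 x.2 bF) hts.
by rewrite -!catA.
Qed.

(** The values of bracket and action on pure tensors are again pure tensors with letters, so the
    operations can be nested without any sign. *)
Definition dbracket c ts : dten := (dmul (unzip1 ts), dop c (unzip2 ts)).

Definition daction c ts y : dten :=
  (dmul (rcons (unzip1 ts) (dop c (rcons (unzip2 ts) y.1))), y.2).

Lemma bracket_words c ts w1 w2 : D c = 1 -> all thomog ts ->
  wsign (w1 ++ c :: twords ts ++ w2) *: lie_bracket mul l (map tens_val ts) =
  wsign (w1 ++ tword (dbracket c ts) ++ w2) *: tens_val (dbracket c ts).
Proof.
move=> c1 hts; have := ext_words [:: c] w1 w2 (bracket_kernel_bimultilinear hA) hts.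
by rewrite /wdeg big_seq1 c1 => ->; rewrite /tword /= -!catA.
Qed.

Lemma action_words c ts y w1 w2 : D c = 1 -> all thomog ts ->
  wsign (w1 ++ c :: twords ts ++ tword y ++ w2) *: lie_action mul l (map tens_val ts) (tens_val y) =
  wsign (w1 ++ tword (daction c ts y) ++ w2) *: tens_val (daction c ts y).
Proof.
move=> c1 hts; have := ext_words [:: c] w1 (tword y ++ w2) (action_kernel_bimultilinear hA (tens_val y)) hts.
rewrite /wdeg big_seq1 c1 => ->; rewrite action_kernel_tens // /tword /tens_val /daction /=.
by rewrite !dvals_rcons !dword_rcons /= !dword_rcons !dvals_rcons -!catA /= -!catA.
Qed.

Lemma all_thomog ts : all thomog ts = all (dhomog D) (unzip1 ts) && all (dhomog D) (unzip2 ts).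
Proof. by elim: ts => //= t ts ->; rewrite /thomog -!andbA; do 2!bool_congr. Qed.

Lemma thomog_dbracket c ts : D c = 1 -> all thomog ts -> (0 < size ts)%N ->
  thomog (dbracket c ts).
Proof.
move=> c1; rewrite all_thomog => /andP[h1 h2] n0.
by rewrite /thomog (dhomog_mul hA) // (dhomog_op hA) // size_map.
Qed.

Lemma thomog_daction c ts y : D c = 1 -> all thomog ts -> thomog y -> thomog (daction c ts y).
Proof.
move=> c1; rewrite all_thomog => /andP[h1 h2] /andP[hy1 hy2].
rewrite /thomog (dhomog_mul hA) //= all_rcons h1 andbT.
by apply: (dhomog_op hA); rewrite ?all_rcons ?hy1 ?size_rcons.
Qed.

Lemma mulseq_tens_perm (gs gs' : seq dec) (v : A) w1 w2 :
  all (dhomog D) gs -> perm_eq gs gs' ->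
  wsign (w1 ++ dword gs ++ w2) *: (mulseq mul (dvals gs) ⊗ v) =
  wsign (w1 ++ dword gs' ++ w2) *: (mulseq mul (dvals gs') ⊗ v).
Proof.
move=> hgs p; rewrite -!(linZ (tens_linearl v)).
by rewrite (graded_symmetric_perm w1 w2 (mulseq_symmetric hmul) hgs p).
Qed.

Lemma op_perm (W : gradedType K) (G : A -> W) (gs gs' : seq dec) w1 w2 : linear G ->
  all (dhomog D) gs -> perm_eq gs gs' ->
  wsign (w1 ++ dword gs ++ w2) *: G (l (dvals gs)) =
  wsign (w1 ++ dword gs' ++ w2) *: G (l (dvals gs')).
Proof.
move=> Gl hgs p; rewrite -!(linZ Gl).
by rewrite (graded_symmetric_perm w1 w2 (Linfty_symmetric hl) hgs p).
Qed.

Lemma dmul_catl (gs gs' : seq dec) : (0 < size gs)%N -> dmul (dmul gs :: gs') = dmul (gs ++ gs').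
Proof.
move=> n0; rewrite /dmul dword_cons /= dword_cat dvals_cat; congr (_, _).
by rewrite -[LHS]/(mulseq mul (mulseq mul (dvals gs) :: dvals gs')) mulseq_catl // size_map.
Qed.

Lemma unzip1_perm ts q : q \in splits ts -> perm_eq (unzip1 q.1 ++ unzip1 q.2) (unzip1 ts).
Proof. by move=> /splits_perm p; rewrite -map_cat perm_map. Qed.

Lemma leibniz_words c (gs xs ys : seq dec) v w : D c = 1 ->
  all (dhomog D) xs -> all (dhomog D) ys -> (0 < size ys)%N ->
  wsign ((dmul (rcons gs (dop c (rcons xs (dmul ys))))).1 ++ w) *:
    ((dmul (rcons gs (dop c (rcons xs (dmul ys))))).2 ⊗ v) =
  \sum_(p <- picks ys)
    wsign ((dmul (gs ++ dop c (rcons xs p.1) :: p.2)).1 ++ w) *: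
      ((dmul (gs ++ dop c (rcons xs p.1) :: p.2)).2 ⊗ (v : A)).
Proof.
move=> c1 hx hy n0; have := leibniz_mulseq hA (dword gs) w c1 hx hy n0.
have Gl : linear (fun z => mulseq mul (rcons (dvals gs) z) ⊗ v).
  by move=> k z z'; rewrite (mulseq_rcons_linear hA) tens_linearl.
move=> /(congr1 (fun z => mulseq mul (rcons (dvals gs) z) ⊗ v)).
rewrite (linZ Gl) (lin_sum Gl) => e.
rewrite [(dmul (rcons gs _)).1]dword_rcons [(dmul (rcons gs _)).2]/= dvals_rcons -catA [LHS]e.
apply: eq_bigr => p _; rewrite (linZ Gl) mulseq_catr //.
by rewrite [(dmul (gs ++ _)).1]dword_cat [(dmul (gs ++ _)).2]/= dvals_cat -catA.
Qed.

Variables (c0 c1 : L).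
Hypotheses (D0 : D c0 = 1) (D1 : D c1 = 1).
Local Notation lie_bracket := (lie_bracket mul l).
Local Notation lie_action := (lie_action mul l).
Local Notation tvals := (map tens_val).

Lemma splits_thomog ts p : all thomog ts -> p \in splits ts ->
  all thomog p.1 && all thomog p.2.
Proof. by move=> h /splits_perm/perm_all e; rewrite -all_cat e. Qed.

Lemma bracket_bracket_words ts : all thomog ts -> (0 < size ts)%N ->
  \sum_(q <- splits ts | (0 < size q.1)%N)
    wsign (c0 :: c1 :: twords q.1 ++ twords q.2) *:
      lie_bracket (lie_bracket (tvals q.1) :: tvals q.2) = 0.
Proof.
move=> hts n0; have := hts; rewrite all_thomog => /andP[h1 h2].
(* Once reordered, all terms share the same first factor; its letters precede those of the two
   operations. *)
have H := Linfty_words hl (dword (unzip1 ts) ++ [:: c0; c1]) [::] h2.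
rewrite size_map in H; have {}H := H n0.
move/(congr1 (tens (mulseq mul (dvals (unzip1 ts))))): H; rewrite linear0 => H.
rewrite -[RHS]H {H} linear_sum.
rewrite splits_map big_map big_seq_cond [RHS]big_seq_cond.
apply: eq_big => [q|q]; first by rewrite size_map.
case/andP=> qs q0; have /andP[hq1 hq2] := splits_thomog hts qs.
rewrite -(linZ (bracket_cons_linear hA _)).
rewrite -[c1 :: _]/([::] ++ c1 :: _) (bracket_words [:: c0] _ D1 hq1).
rewrite (linZ (bracket_cons_linear hA _)).
have hd : all thomog (dbracket c1 q.1 :: q.2) by rewrite /= thomog_dbracket.
have := bracket_words [::] [::] D0 hd; rewrite /= !cats0 => ->.
rewrite /dbracket /= dmul_catl ?size_map // (linZ (tens_linearr _)) -!catA.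
apply: (mulseq_tens_perm _ [::]); last exact: unzip1_perm.
by move: hq1 hq2; rewrite !all_thomog all_cat => /andP[-> _] /andP[-> _].
Qed.

Lemma picks_thomog ts p : all thomog ts -> p \in picks ts -> thomog p.1 && all thomog p.2.
Proof. by move=> h /picks_perm/perm_all e; rewrite -[_ && _]/(all thomog (_ :: _)) e. Qed.

Lemma action_bracket_words xs ys : all thomog xs -> all thomog ys -> (0 < size ys)%N ->
  wsign (c0 :: twords xs ++ c1 :: twords ys) *: lie_action (tvals xs) (lie_bracket (tvals ys)) +
  \sum_(k <- picks ys)
    wsign (c0 :: c1 :: twords xs ++ tword k.1 ++ twords k.2) *:
      lie_bracket (lie_action (tvals xs) (tens_val k.1) :: tvals k.2) = 0.
Proof.
move=> hxs hys n0.
have := hxs; rewrite all_thomog => /andP[hx1 hx2].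
have := hys; rewrite all_thomog => /andP[hy1 hy2].
have hb : thomog (dbracket c1 ys) by apply: thomog_dbracket.
rewrite -(linZ (action_linear hA _)) -[c1 :: _]cats0 cat_cons.
rewrite -cat_cons (bracket_words (c0 :: twords xs) [::] D1 hys) (linZ (action_linear hA _)).
have := action_words (dbracket c1 ys) [::] [::] D0 hxs; rewrite !cats0 => -> {hb}.
have := leibniz_words (unzip1 xs) (dop c1 (unzip2 ys)).2 (dop c1 (unzip2 ys)).1 D0 hx2 hy1.
rewrite size_map => /(_ n0) e; rewrite [X in X + _]e {e} picks_map big_map -big_split /=.
rewrite big_seq big1 // => k ks; have /andP[hk1 hk2] := picks_thomog hys ks.
have hd : all thomog (daction c1 xs k.1 :: k.2) by rewrite /= hk2 thomog_daction.
rewrite -(linZ (bracket_cons_linear hA _)) -[c0 :: _]/([:: c0] ++ _).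
rewrite -cat_cons (action_words _ [:: c0] _ D1 hxs) (linZ (bracket_cons_linear hA _)).
have := bracket_words [::] [::] D0 hd; rewrite /= !cats0 => ->.
rewrite /dbracket /daction /= dmul_catl ?size_rcons // cat_rcons.
rewrite /tword /tens_val /=.
(* In the second family the chosen tensor is the first argument of the bracket, so its second
   component has to come first in [l]. *)
have p2 : perm_eq (unzip2 ys) (k.1.2 :: unzip2 k.2).
  by rewrite perm_sym; have := picks_perm ks; move/(perm_map (fun t : dten => t.2)).
have := op_perm (_ ++ [:: c1]) [::] (tens_linearr _) hy2 p2.
rewrite !cats0 => op2; rewrite -[c1 :: dword (unzip2 ys)]cat1s catA op2 {op2}.
rewrite -!catA !dword_cat !dword_cons /= -!catA /= wsign_odd_letters // scaleNr.
by rewrite !dvals_cat; apply: addNr.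
Qed.

(** The two sums are the two halves of the L-infinity identity for the second components of [xs]
    followed by [y.1]: the inner operation takes [y.1] or it does not. *)
Lemma action_linfty_words xs y : all thomog xs -> thomog y ->
  \sum_(p <- splits xs | (0 < size p.1)%N)
    wsign (c0 :: c1 :: twords p.1 ++ twords p.2 ++ tword y) *:
      lie_action (lie_bracket (tvals p.1) :: tvals p.2) (tens_val y) +
  \sum_(p <- splits xs)
    wsign ((dmul (unzip1 p.1 ++
      dop c0 (rcons (unzip2 p.1) (dop c1 (rcons (unzip2 p.2) y.1))) :: unzip1 p.2)).1 ++ y.2.1) *:
    ((dmul (unzip1 p.1 ++
      dop c0 (rcons (unzip2 p.1) (dop c1 (rcons (unzip2 p.2) y.1))) :: unzip1 p.2)).2 ⊗ y.2.2) = 0.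
Proof.
move=> hxs hy; have := hxs; rewrite all_thomog => /andP[hx1 hx2].
have /andP[hy1 hy2] := hy.
pose G z := mulseq mul (rcons (dvals (unzip1 xs)) z) ⊗ y.2.2.
have Gl : linear G by move=> c z z'; rewrite /G (mulseq_rcons_linear hA) tens_linearl.
have hxy : all (dhomog D) (rcons (unzip2 xs) y.1) by rewrite all_rcons hy1.
have := Linfty_words hl (dword (unzip1 xs) ++ [:: c0; c1]) y.2.1 hxy.
rewrite size_rcons => /(_ isT) /(congr1 G); rewrite (lin0 Gl) => H.
rewrite -[RHS]H {H} (lin_sum Gl) [RHS]big_mkcond big_splits_rcons addrC; congr (_ + _).
  (* The parts trade places: the first part feeds the inner operation in the L-infinity identity,
     but the outer one in the statement. *)
  rewrite big_splitsC splits_map big_map big_seq [RHS]big_seq; apply: eq_bigr => p ps.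
  have /andP[hp1 hp2] := splits_thomog hxs ps.
  rewrite /= size_rcons /= (linZ Gl) -!catA.
  have h1 : all (dhomog D) (unzip1 p.1) && all (dhomog D) (unzip1 p.2).
    by move: hp1 hp2; rewrite !all_thomog => /andP[-> _] /andP[-> _].
  have h2 : all (dhomog D) (unzip2 p.1) && all (dhomog D) (unzip2 p.2).
    by move: hp1 hp2; rewrite !all_thomog => /andP[_ ->] /andP[_ ->].
  have hE : dhomog D (dop c1 (rcons (unzip2 p.2) y.1)).
    by apply: (dhomog_op hA); rewrite ?all_rcons ?hy1 ?size_rcons //; case/andP: h2.
  have hF : dhomog D (dop c0 (rcons (unzip2 p.1) (dop c1 (rcons (unzip2 p.2) y.1)))).
    by apply: (dhomog_op hA); rewrite ?all_rcons ?hE ?size_rcons //; case/andP: h2.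
  have hl1 : all (dhomog D) (unzip1 p.1 ++
      dop c0 (rcons (unzip2 p.1) (dop c1 (rcons (unzip2 p.2) y.1))) :: unzip1 p.2).
    by rewrite all_cat /= hF.
  have pm : perm_eq (unzip1 p.1 ++
      dop c0 (rcons (unzip2 p.1) (dop c1 (rcons (unzip2 p.2) y.1))) :: unzip1 p.2)
      (rcons (unzip1 xs) (dop c0 (rcons (unzip2 p.1) (dop c1 (rcons (unzip2 p.2) y.1))))).
    apply/seq.permP => P; rewrite -[rcons (unzip1 xs) _]cats1 !count_cat /= addn0.
    by have/seq.permP/(_ P) := unzip1_perm ps; rewrite count_cat => <-; rewrite addnCA [RHS]addnC.
  have := mulseq_tens_perm y.2.2 [::] y.2.1 hl1 pm; rewrite /= => -> {hl1 pm hF}.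
  rewrite dword_rcons dvals_rcons -catA /=.
  have pE : perm_eq (rcons (unzip2 p.1) (dop c1 (rcons (unzip2 p.2) y.1)))
      (dop c1 (rcons (unzip2 p.2) y.1) :: unzip2 p.1) by rewrite perm_rcons.
  have hl2 : all (dhomog D) (rcons (unzip2 p.1) (dop c1 (rcons (unzip2 p.2) y.1))).
    by rewrite all_rcons hE; case/andP: h2.
  have := op_perm (dword (unzip1 xs) ++ [:: c0]) y.2.1 Gl hl2 pE.
  by rewrite -!catA => e; rewrite [LHS]e.
rewrite -big_mkcond splits_map big_map big_seq_cond [RHS]big_seq_cond.
apply: eq_big => [p|p]; first by rewrite size_map.
case/andP=> ps p0; have /andP[hp1 hp2] := splits_thomog hxs ps.
rewrite -(linZ (action_cons_linear hA _ _)).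
rewrite -[c0 :: _]/([:: c0] ++ _) (bracket_words [:: c0] _ D1 hp1).
rewrite (linZ (action_cons_linear hA _ _)).
have hd : all thomog (dbracket c1 p.1 :: p.2) by rewrite /= thomog_dbracket.
have e := action_words y [::] [::] D0 hd; rewrite !cats0 in e.
rewrite [tword _ ++ twords p.2 ++ tword y]catA [LHS]e {e}.
rewrite /daction /dbracket [unzip1 _]/= [unzip2 _]/= rcons_cons dmul_catl ?size_map //.
have h1 : all (dhomog D) (unzip1 p.1) && all (dhomog D) (unzip1 p.2).
  by move: hp1 hp2; rewrite !all_thomog => /andP[-> _] /andP[-> _].
have h2 : all (dhomog D) (unzip2 p.1) && all (dhomog D) (unzip2 p.2).
  by move: hp1 hp2; rewrite !all_thomog => /andP[_ ->] /andP[_ ->].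
have hE : dhomog D (dop c1 (unzip2 p.1)).
  by apply: (dhomog_op hA); rewrite ?size_map //; case/andP: h2.
have hF : dhomog D (dop c0 (dop c1 (unzip2 p.1) :: rcons (unzip2 p.2) y.1)).
  by apply: (dhomog_op hA); rewrite //= all_rcons hE hy1; case/andP: h2.
set g := dop c0 _.
have pm : perm_eq (unzip1 p.1 ++ rcons (unzip1 p.2) g) (rcons (unzip1 xs) g).
  rewrite -rcons_cat -[rcons (_ ++ _) g]cats1 -[rcons (unzip1 xs) g]cats1 perm_cat2r.
  exact: unzip1_perm.
have hg : all (dhomog D) (unzip1 p.1 ++ rcons (unzip1 p.2) g) by rewrite all_cat all_rcons hF.
have e := mulseq_tens_perm y.2.2 [::] y.2.1 hg pm.
rewrite [LHS]e dword_rcons dvals_rcons (linZ Gl); congr (wsign _ *: _).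
by rewrite /= dword_cons -!catA /= -!catA.
Qed.

Lemma action_action_words xs y : all thomog xs -> thomog y ->
  \sum_(p <- splits xs) \sum_(k <- picks p.2)
    wsign (c0 :: c1 :: twords p.1 ++ tword k.1 ++ twords k.2 ++ tword y) *:
      lie_action (lie_action (tvals p.1) (tens_val k.1) :: tvals k.2) (tens_val y) +
  \sum_(p <- splits xs | (0 < size p.1)%N)
    wsign (c0 :: c1 :: twords p.1 ++ twords p.2 ++ tword y) *:
      lie_action (lie_bracket (tvals p.1) :: tvals p.2) (tens_val y) +
  \sum_(p <- splits xs)
    wsign (c0 :: twords p.1 ++ c1 :: twords p.2 ++ tword y) *:
      lie_action (tvals p.1) (lie_action (tvals p.2) (tens_val y)) = 0.
Proof.
move=> hxs hy; have := hxs; rewrite all_thomog => /andP[hx1 hx2].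
have /andP[hy1 hy2] := hy.
have E := action_linfty_words hxs hy; rewrite addrAC -[RHS]E {E}.
rewrite addrC; congr (_ + _); rewrite -big_split big_seq [RHS]big_seq.
apply: eq_bigr => p ps; have /andP[hp1 hp2] := splits_thomog hxs ps.
have h1 : all (dhomog D) (unzip1 p.1) && all (dhomog D) (unzip1 p.2).
  by move: hp1 hp2; rewrite !all_thomog => /andP[-> _] /andP[-> _].
have h2 : all (dhomog D) (unzip2 p.1) && all (dhomog D) (unzip2 p.2).
  by move: hp1 hp2; rewrite !all_thomog => /andP[_ ->] /andP[_ ->].
set E := dop c1 (rcons (unzip2 p.2) y.1).
have hE : dhomog D E.
  by apply: (dhomog_op hA); rewrite ?all_rcons ?hy1 ?size_rcons //; case/andP: h2.
have e3 : wsign (c0 :: twords p.1 ++ c1 :: twords p.2 ++ tword y) *: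
      lie_action (tvals p.1) (lie_action (tvals p.2) (tens_val y)) =
    wsign ((dmul (rcons (unzip1 p.1)
      (dop c0 (rcons (unzip2 p.1) (dmul (rcons (unzip1 p.2) E)))))).1 ++ y.2.1) *:
    ((dmul (rcons (unzip1 p.1)
      (dop c0 (rcons (unzip2 p.1) (dmul (rcons (unzip1 p.2) E)))))).2 ⊗ y.2.2).
  rewrite -(linZ (action_linear hA _)).
  have e := action_words y (c0 :: twords p.1) [::] D1 hp2; rewrite !cats0 in e.
  rewrite [X in lie_action _ X]e (linZ (action_linear hA _)) {e}.
  have e := action_words (daction c1 p.2 y) [::] [::] D0 hp1; rewrite !cats0 in e.
  exact: e.
have hlE : all (dhomog D) (rcons (unzip1 p.2) E) by rewrite all_rcons hE; case/andP: h1.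
have [hx21 hx22] := andP h2.
(* [big_picks_rcons] detaches the Leibniz term in which the outer [l] hits the inner one; it belongs
   to the L-infinity identity, and the other terms must cancel. *)
rewrite -[LHS]/(_ + _) e3 leibniz_words ?size_rcons // big_picks_rcons addrA picks_map big_map -big_split /=.
rewrite big_seq big1 ?add0r // => k ks; have /andP[hk1 hk2] := picks_thomog hp2 ks.
have hd : all thomog (daction c1 p.1 k.1 :: k.2) by rewrite /= hk2 thomog_daction.
rewrite -(linZ (action_cons_linear hA _ _)).
have e := action_words k.1 [:: c0] (twords k.2 ++ tword y) D1 hp1.
rewrite [X in lie_action (X :: _)]e (linZ (action_cons_linear hA _ _)) {e}.
have e := action_words y [::] [::] D0 hd; rewrite !cats0 in e.
rewrite [tword _ ++ twords k.2 ++ tword y]catA [X in X + _ = _]e {e hd}.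
rewrite /daction [unzip1 _]/= [unzip2 _]/= rcons_cons dmul_catl ?size_rcons // cat_rcons.
rewrite -[unzip2 (_ :: k.2)]/(k.1.2 :: unzip2 k.2) -[[seq i.1 | i <- k.2]]/(unzip1 k.2).
(* A common form for both kinds of terms, with the two operation letters exposed: they differ only
   by exchanging [c] and [c']. *)
have nf c c' (m q : seq dec) :
    wsign ((dmul (unzip1 p.1 ++ dop c m :: rcons (unzip1 k.2) (dop c' q))).1 ++ y.2.1) *:
    ((dmul (unzip1 p.1 ++ dop c m :: rcons (unzip1 k.2) (dop c' q))).2 ⊗ y.2.2) =
    wsign (dword (unzip1 p.1) ++ c :: (dword m ++ dword (unzip1 k.2)) ++ c' :: dword q ++ y.2.1) *:
    (mulseq mul (dvals (unzip1 p.1) ++ l (dvals m) :: rcons (dvals (unzip1 k.2)) (l (dvals q))) ⊗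
       y.2.2).
  rewrite [(dmul _).1]dword_cat dword_cons dword_rcons /= -!catA /= -!catA.
  by rewrite dvals_cat /= dvals_rcons.
set m := rcons (unzip2 p.1) k.1.1; set q := rcons (k.1.2 :: _) _.
rewrite [X in X + _ = _](nf c1 c0 m q).
have pq : perm_eq (rcons (unzip2 p.2) y.1) q.
  rewrite /q rcons_cons -cat1s -!cats1 catA perm_cat2r perm_sym.
  by have := picks_perm ks; move/(perm_map (fun t : dten => t.2)).
pose s := unzip1 p.1 ++ dop c0 m :: unzip1 k.2.
have Gl : linear (fun z => mulseq mul (rcons (dvals s) z) ⊗ y.2.2).
  by move=> c z z'; rewrite (mulseq_rcons_linear hA) tens_linearl.
have hq : all (dhomog D) (rcons (unzip2 p.2) y.1) by rewrite all_rcons hy1; case/andP: h2.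
have e := op_perm (dword s ++ [:: c1]) y.2.1 Gl hq pq.
have eE g : unzip1 p.1 ++ dop c0 m :: rcons (unzip1 k.2) g = rcons s g.
  by rewrite /s rcons_cat.
have eT gs : wsign ((dmul (rcons s (dop c1 gs))).1 ++ y.2.1) *:
      ((dmul (rcons s (dop c1 gs))).2 ⊗ y.2.2) =
    wsign ((dword s ++ [:: c1]) ++ dword gs ++ y.2.1) *:
      (mulseq mul (rcons (dvals s) (l (dvals gs))) ⊗ y.2.2).
  by rewrite [(dmul _).1]dword_rcons [(dmul _).2]/= dvals_rcons -catA -[in RHS]catA.
rewrite eE [X in _ + X = _]eT [X in _ + X = _]e -eT -eE [X in _ + X = _](nf c0 c1 m q).
by rewrite wsign_odd_letters // scaleNr; apply: addNr.
Qed.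

End TensorWords.

Arguments thomog {disp L K} D {A} t.

Lemma scaler_if (K : fieldType) (V : lmodType K) (b : bool) (c : K) (x : V) :
  c *: (if b then x else 0) = if b then c *: x else 0.
Proof. by case: b; rewrite ?scaler0. Qed.

Lemma big_splits_size1_pos (U : nmodType) (T : Type) (w : seq T) (F : seq T * seq T -> U) :
  \sum_(q <- splits w | (0 < size q.1)%N) (if size q.1 == 1%N then F q else 0) =
  \sum_(k <- picks w) F ([:: k.1], k.2).
Proof.
rewrite -big_splits_size1 -big_mkcondr; apply: eq_bigl => q.
by case: (size q.1) => [|[]].
Qed.

Lemma big_splits_if_nil1 (U : nmodType) (T : Type) (w : seq T) (F : seq T * seq T -> U) :
  \sum_(p <- splits w) (if nilp p.1 then F p else 0) = F ([::], w).
Proof. by rewrite -big_mkcond big_splits_nil1. Qed.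

Lemma big_splits_if_nil2_pos (U : nmodType) (T : Type) (w : seq T) (F : seq T * seq T -> U) :
  (0 < size w)%N ->
  \sum_(q <- splits w | (0 < size q.1)%N) (if nilp q.2 then F q else 0) = F (w, [::]).
Proof.
move=> w0; rewrite big_mkcond -[RHS](big_splits_nil2 F) [RHS]big_mkcond.
elim: w F w0 => // x w IH F _; rewrite !big_splits_cons /=; congr (_ + _).
case: (posnP (size w)) => [/size0nil->|w0]; first by rewrite /= !big_seq1.
by rewrite !big1 // => q _; case: ifP.
Qed.

(** * Expansion of the identity for [opM] into its bracket and action parts *)

Section OpWords.
Variables (disp : Order.disp_t) (L : orderType disp) (K : fieldType) (D : L -> int).
Variables (A : gradedType K) (mul : A -> A -> A) (l : seq A -> A).
Hypothesis hA : homotopy_Poisson_algebra mul l.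
Local Notation dten := ((seq L * A) * (seq L * A))%type.
Local Notation wsign := (wsign K D).
Local Notation M := (opM mul l).
Local Notation lie_bracket := (lie_bracket mul l).
Local Notation lie_action := (lie_action mul l).
Local Notation tvals := (map (@tens_val _ L K A)).
Local Notation thomog := (thomog D).
Variables (c0 c1 : L).
Hypotheses (D0 : D c0 = 1) (D1 : D c1 = 1).

Lemma opM_cons z (xs ys : seq (tensor A A)) :
  M (z :: xs) ys = if size ys == 1%N then lie_action (z :: xs) (head 0 ys) else 0.
Proof. by rewrite /opM addr0. Qed.

(** The outer operation has a nonempty left argument, so it is an action and needs a single [y]. An
    inner bracket forces [p.1] to be empty, an inner action forces [q.1] to be a single tensor. *)
Lemma opM_words_left (xs ys : seq dten) :
  \sum_(p <- splits xs) \sum_(q <- splits p.2 | (0 < size q.1)%N)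
    wsign (c0 :: c1 :: twords p.1 ++ twords q.1 ++ twords q.2 ++ twords ys) *:
      M (M (tvals p.1) (tvals q.1) :: tvals q.2) (tvals ys) =
  if size ys == 1%N then
    \sum_(p <- splits xs) \sum_(k <- picks p.2)
      wsign (c0 :: c1 :: twords p.1 ++ tword k.1 ++ twords k.2 ++ twords ys) *:
        lie_action (lie_action (tvals p.1) (tens_val k.1) :: tvals k.2) (head 0 (tvals ys)) +
    \sum_(p <- splits xs | (0 < size p.1)%N)
      wsign (c0 :: c1 :: twords p.1 ++ twords p.2 ++ twords ys) *:
        lie_action (lie_bracket (tvals p.1) :: tvals p.2) (head 0 (tvals ys))
  else 0.
Proof.
under eq_bigr do under eq_bigr do rewrite opM_cons scaler_if size_map.
case: (size ys == 1%N); last by rewrite big1 // => p _; rewrite big1.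
set y := head 0 _.
pose F (p : seq dten) (q : seq dten * seq dten) := wsign (c0 :: c1 :: twords p ++ twords q.1 ++ twords q.2 ++ twords ys) *:
  lie_action (lie_action (tvals p) (head 0 (tvals q.1)) :: tvals q.2) y.
pose G (p : seq dten) (q : seq dten * seq dten) := wsign (c0 :: c1 :: twords p ++ twords q.1 ++ twords q.2 ++ twords ys) *:
  lie_action (lie_bracket (tvals q.1) :: tvals q.2) y.
transitivity (\sum_(p <- splits xs) (\sum_(q <- splits p.2 | (0 < size q.1)%N)
    (if size q.1 == 1%N then F p.1 q else 0) +
  (if nilp p.1 then \sum_(q <- splits p.2 | (0 < size q.1)%N) G p.1 q else 0))).
  apply: eq_bigr => p _; 
  have e : (if nilp p.1 then \sum_(q <- splits p.2 | (0 < size q.1)%N) G p.1 q else 0) =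
      \sum_(q <- splits p.2 | (0 < size q.1)%N) (if nilp p.1 then G p.1 q else 0).
    by case: (nilp p.1) => //; rewrite big1.
  rewrite e -big_split; apply: eq_bigr => q _ /=.
  rewrite {1}/opM (linD (action_cons_linear hA _ _)) scalerDr /nilp !size_map.
  congr (_ + _); case: ifP => // _; by rewrite (lin0 (action_cons_linear hA _ _)) scaler0.
rewrite big_split big_splits_if_nil1 /=; congr (_ + _).
apply: eq_bigr => p _; rewrite big_splits_size1_pos; apply: eq_bigr => k _.
by rewrite /F /twords /= cats0.
Qed.

(** Expanding both operations gives four kinds of terms. An outer action needs [q.2] empty and an
    outer bracket [p.1] empty; an inner action needs [q.1] to be a single tensor and an inner
    bracket [p.2] empty. Each kind thus collapses to a shorter sum. *)
Lemma opM_words_right (xs ys : seq dten) : (0 < size ys)%N ->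
  \sum_(p <- splits xs) \sum_(q <- splits ys | (0 < size q.1)%N)
    wsign (c0 :: twords p.1 ++ c1 :: twords p.2 ++ twords q.1 ++ twords q.2) *:
      M (tvals p.1) (M (tvals p.2) (tvals q.1) :: tvals q.2) =
  (if size ys == 1%N then
    \sum_(p <- splits xs)
      wsign (c0 :: twords p.1 ++ c1 :: twords p.2 ++ twords ys) *:
        lie_action (tvals p.1) (lie_action (tvals p.2) (head 0 (tvals ys)))
   else 0) +
  (wsign (c0 :: twords xs ++ c1 :: twords ys) *: lie_action (tvals xs) (lie_bracket (tvals ys)) +
   \sum_(k <- picks ys)
     wsign (c0 :: c1 :: twords xs ++ tword k.1 ++ twords k.2) *:
       lie_bracket (lie_action (tvals xs) (tens_val k.1) :: tvals k.2)) +
  (if nilp xs then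
    \sum_(q <- splits ys | (0 < size q.1)%N)
      wsign (c0 :: c1 :: twords q.1 ++ twords q.2) *:
        lie_bracket (lie_bracket (tvals q.1) :: tvals q.2)
   else 0).
Proof.
move=> n0; pose s (p q : seq dten * seq dten) :=
  wsign (c0 :: twords p.1 ++ c1 :: twords p.2 ++ twords q.1 ++ twords q.2).
pose FA p q := s p q *: lie_action (tvals p.1) (lie_action (tvals p.2) (head 0 (tvals q.1))).
pose FB p q := s p q *: lie_action (tvals p.1) (lie_bracket (tvals q.1)).
pose FC p q := s p q *: lie_bracket (lie_action (tvals p.2) (head 0 (tvals q.1)) :: tvals q.2).
pose FD p q := s p q *: lie_bracket (lie_bracket (tvals q.1) :: tvals q.2).
transitivity (\sum_(p <- splits xs)
  (\sum_(q <- splits ys | (0 < size q.1)%N)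
     (if nilp q.2 then if size q.1 == 1%N then FA p q else 0 else 0) +
  (\sum_(q <- splits ys | (0 < size q.1)%N)
     (if nilp q.2 then if nilp p.2 then FB p q else 0 else 0) +
   \sum_(q <- splits ys | (0 < size q.1)%N)
     (if size q.1 == 1%N then if nilp p.1 then FC p q else 0 else 0)) +
   (if nilp p.1 then \sum_(q <- splits ys | (0 < size q.1)%N)
     (if nilp p.2 then FD p q else 0) else 0))).
  apply: eq_bigr => p _.
  have -> : (if nilp p.1 then \sum_(q <- splits ys | (0 < size q.1)%N)
       (if nilp p.2 then FD p q else 0) else 0) =
     \sum_(q <- splits ys | (0 < size q.1)%N)
       (if nilp p.1 then if nilp p.2 then FD p q else 0 else 0).
    by case: (nilp p.1) => //; rewrite big1.
  rewrite -!big_split; apply: eq_bigr => q _ /=.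
  rewrite /opM /= eqSS /nilp !size_map /FA /FB /FC /FD /s.
  case: (size q.1 == 1)%N; case: (size p.1 == 0)%N; case: (size p.2 == 0)%N;
    case: (size q.2 == 0)%N; rewrite ?addr0 ?add0r ?(lin0 (action_linear hA _))
      ?(lin0 (bracket_cons_linear hA _)) ?addr0 ?add0r ?scaler0 //;
    rewrite ?scalerDr ?(linD (action_linear hA _)) ?(linD (bracket_cons_linear hA _)) ?scalerDr //;
    by rewrite ?addrA // addrAC.
rewrite !big_split /=; congr (_ + (_ + _) + _).
- rewrite (eq_bigr (fun p => if size ys == 1%N then FA p (ys, [::]) else 0)) => [|p _].
    case: ifP => _; last by rewrite big1.
    by apply: eq_bigr => p _; rewrite /FA /s /twords /= !cats0.
  by rewrite big_splits_if_nil2_pos.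
- rewrite (eq_bigr (fun p => if nilp p.2 then FB p (ys, [::]) else 0)) => [|p _].
    by rewrite -big_mkcond big_splits_nil2 /FB /s /twords /= !cats0.
  by rewrite big_splits_if_nil2_pos.
- rewrite (eq_bigr (fun p => if nilp p.1 then \sum_(k <- picks ys) FC p ([:: k.1], k.2) else 0)).
    rewrite big_splits_if_nil1; apply: eq_bigr => k _.
    by rewrite /FC /s /twords /= cats0.
  move=> p _; rewrite big_splits_size1_pos.
  by case: (nilp p.1) => //; rewrite big1.
rewrite big_splits_if_nil1 /=; case: ifP => xs0; last by rewrite big1.
by case: (xs) xs0.
Qed.

Lemma opM_words (xs ys : seq dten) : all thomog xs -> all thomog ys -> (0 < size ys)%N ->
  \sum_(p <- splits xs) \sum_(q <- splits p.2 | (0 < size q.1)%N)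
    wsign (c0 :: c1 :: twords p.1 ++ twords q.1 ++ twords q.2 ++ twords ys) *:
      M (M (tvals p.1) (tvals q.1) :: tvals q.2) (tvals ys) +
  \sum_(p <- splits xs) \sum_(q <- splits ys | (0 < size q.1)%N)
    wsign (c0 :: twords p.1 ++ c1 :: twords p.2 ++ twords q.1 ++ twords q.2) *:
      M (tvals p.1) (M (tvals p.2) (tvals q.1) :: tvals q.2) = 0.
Proof.
move=> hxs hys n0; rewrite opM_words_left opM_words_right //.
rewrite (action_bracket_words hA D0 D1 hxs hys n0) (bracket_bracket_words hA D0 D1 hys n0).
rewrite if_same !addr0; case: ifP => ys1; last by rewrite addr0.
case: ys ys1 hys {n0} => [|y [|]] // _ /andP[hy _].
have := action_action_words hA D0 D1 hxs hy.
by rewrite /twords /= cats0.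
Qed.

End OpWords.

(** * Reduction to pure homogeneous tensors *)

Section Update.
Variables (I : eqType) (V : Type).
Implicit Types (z : I -> V) (s : seq I).

Definition upd z k u : I -> V := fun i => if i == k then u else z i.

Lemma upd_id z k : upd z k (z k) = z.
Proof. by apply: funext => i; rewrite /upd; case: eqP => // ->. Qed.

Lemma map_upd_notin z k u s : k \notin s -> map (upd z k u) s = map z s.
Proof.
move=> ks; apply/eq_in_map => i si; rewrite /upd; case: eqP => // e.
by rewrite -e si in ks.
Qed.

Lemma map_upd_in z k s : uniq s -> k \in s ->
  exists s1 s2, forall u, map (upd z k u) s = map z s1 ++ u :: map z s2.
Proof.
move=> us /splitPr ks; case: ks us => s1 s2; rewrite cat_uniq /= negb_or -!andbA.
move=> /and5P[_ k1 _ k2 _]; exists s1, s2 => u.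
by rewrite map_cat /= !map_upd_notin // /upd eqxx.
Qed.

End Update.

Section PureTensors.
Variables (K : fieldType) (A : gradedType K) (I : finType) (d : I -> int) (U : lmodType K).
Local Notation V := (tensor A A).

Definition pure_homogeneous n (v : V) := exists p : int * int * (A * A),
  [/\ p.1.1 + p.1.2 = n, homogeneous p.1.1 p.2.1, homogeneous p.1.2 p.2.2 & v = p.2.1 ⊗ p.2.2].

Lemma pure_homogeneous_ind (Phi : (I -> V) -> U) :
  (forall z k, linear (fun u => Phi (upd z k u))) ->
  (forall z, (forall k, pure_homogeneous (d k) (z k)) -> Phi z = 0) ->
  forall z, (forall k, homogeneous (d k) (z k)) -> Phi z = 0.
Proof.
move=> Phil Phi0 z hz.
(* The list [r] holds the arguments that may not yet be pure; the induction decomposes them one at a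
   time. *)
suff H (r : seq I) : forall z, (forall k, homogeneous (d k) (z k)) ->
    (forall k, k \notin r -> pure_homogeneous (d k) (z k)) -> Phi z = 0.
  by apply: (H (enum I)) => // k; rewrite mem_enum.
elim: r => [|k r IH] {hz}z hz pz; first by apply: Phi0 => k; apply: pz.
have [q [hq e]] := homogeneous_tensor_decomposition (hz k).
rewrite -(upd_id z k) e (lin_sum (Phil z k)) big_seq big1 // => p /hq[p1 p2 p3].
apply: IH => i; rewrite /upd; case: eqP => [->|ik]; try exact: hz.
- by rewrite -p1; apply: homogeneous_tens.
- by move=> _; exists p.
by move=> ir; apply: pz; rewrite inE negb_or ir andbT; apply/eqP.
Qed.

End PureTensors.

(** * Multilinearity, symmetry and degree of [opM] *)

Section OpMStructure.
Variables (K : fieldType) (A : gradedType K) (mul : A -> A -> A) (l : seq A -> A).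
Hypothesis hA : homotopy_Poisson_algebra mul l.
Local Notation V := (tensor A A).
Local Notation M := (opM mul l).

Let hmul := hPoisson_comm_algebra hA.
Let hl := hPoisson_Linfty hA.

Lemma opM_multilinearl ys : multilinear (M^~ ys).
Proof.
move=> c x y s t; rewrite /opM scalerDr addrACA; congr (_ + _).
  by case: ifP => _; rewrite ?scaler0 ?addr0 // (action_multilinear hA).
by case: s => [|? ?]; rewrite /= scaler0 addr0.
Qed.

Lemma opM_multilinearr xs : multilinear (M xs).
Proof.
move=> c x y s t; rewrite /opM scalerDr addrACA !size_cat /=; congr (_ + _).
  case: ifP; rewrite ?scaler0 ?addr0 // => st.
  have /andP[/nilP-> /nilP->] : nilp s && nilp t by move: st; rewrite addnS eqSS addn_eq0.
  by rewrite /= (action_linear hA).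
by case: ifP => _; rewrite ?scaler0 ?addr0 // (bracket_multilinear hA).
Qed.

Lemma opM_symmetricl ys : graded_symmetric (M^~ ys).
Proof.
move=> i j x y s t hx hy; rewrite /opM scalerDr; congr (_ + _).
  case: ifP => _; rewrite ?scaler0 //.
  exact: (ext_symmetric _ (action_kernel_bimultilinear hA _) (action_kernel_symmetric hA _) _ _ hx hy).
by case: s => [|? ?]; rewrite /= scaler0.
Qed.

Lemma opM_symmetricr xs : graded_symmetric (M xs).
Proof.
move=> i j x y s t hx hy; rewrite /opM scalerDr !size_cat /= !addnS; congr (_ + _).
  by rewrite scaler0.
case: ifP => _; rewrite ?scaler0 //.
exact: (ext_symmetric _ (bracket_kernel_bimultilinear hA) (bracket_kernel_symmetric hA) _ _ hx hy).
Qed.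

Lemma args_pairs n (T : Type) (d : 'I_n -> int) (x : 'I_n -> T) :
  args x = map snd [seq (d i, x i) | i <- enum 'I_n].
Proof. by rewrite -map_comp. Qed.

Lemma l_degree (s : seq (int * A)) : {in s, forall p, homogeneous p.1 p.2} -> (0 < size s)%N ->
  homogeneous (1 + \sum_(p <- s) p.1) (l (map snd s)).
Proof.
move=> hs s0; pose p0 : int * A := (0, 0); pose g (i : 'I_(size s)) := nth p0 s i.
have sE : s = map g (enum 'I_(size s)).
  by rewrite (map_comp (nth p0 s) val) val_enum_ord map_nth_iota0 // take_size.
have hg i : homogeneous (g i).1 (g i).2 by apply/hs/mem_nth.
have := Linfty_degree hl s0 hg.
by rewrite [in X in _ -> X]sE big_map big_enum /args -map_comp.
Qed.

Lemma mulseq_degree (s : seq (int * A)) : {in s, forall p, homogeneous p.1 p.2} ->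
  homogeneous (\sum_(p <- s) p.1) (mulseq mul (map snd s)).
Proof.
elim: s => [|p s IH] hs; first exact: homogeneous0.
have hp : homogeneous p.1 p.2 by apply: hs; rewrite mem_head.
case: (posnP (size s)) => [/size0nil->|s0]; first by rewrite big_seq1.
rewrite big_cons [map _ _]/= mulseq_cons ?size_map //; apply: gmul_degree => //.
by apply: IH => q qs; apply: hs; rewrite inE qs orbT.
Qed.

Lemma opM_degree (p q : nat) (x : 'I_p -> V) (y : 'I_q -> V)
    (dx : 'I_p -> int) (dy : 'I_q -> int) : (0 < q)%N ->
  (forall i, homogeneous (dx i) (x i)) -> (forall i, homogeneous (dy i) (y i)) ->
  homogeneous (1 + (\sum_(i < p) dx i + \sum_(i < q) dy i)) (M (args x) (args y)).
Proof.
have mem n (d : 'I_n -> int) (a : 'I_n -> A) : (forall i, homogeneous (d i) (a i)) ->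
    {in [seq (d i, a i) | i <- enum 'I_n], forall p, homogeneous p.1 p.2}.
  by move=> ha _ /mapP[i _ ->]; apply: ha.
have sumE n (d : 'I_n -> int) (a : 'I_n -> A) :
    \sum_(p <- [seq (d i, a i) | i <- enum 'I_n]) p.1 = \sum_i d i.
  by rewrite big_map big_enum.
move=> q0 hx hy; rewrite /opM; apply: homogeneousD.
  case: ifP => [|_]; last exact: homogeneous0.
  rewrite /args size_map size_enum_ord => /eqP q1; subst q.
  rewrite enum_ordSl enum_ord0 big_ord1 /=.
  have -> : 1 + (\sum_i dx i + dy ord0) = (1 + dy ord0) + \sum_i dx i by ring.
  apply: ext_degree => //; first exact: action_kernel_bimultilinear.
  move=> a b da db ha hb; rewrite (args_pairs da a) (args_pairs db b).
  have [r [hr ->]] := homogeneous_tensor_decomposition (hy ord0).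
  rewrite /action_kernel (lin_sum (tlift_is_linear (action_kernel_linearl hA _ _)
    (action_kernel_linearr _ _ _ _))) [X in homogeneous _ X]big_seq.
  apply: (big_ind (homogeneous _)); [exact: homogeneous0 | exact: homogeneousD |].
  move=> -[[dc de] [c e]] /hr[/= <- hc he]; rewrite -/(action_kernel _ _ _ _ _) action_kernel_tens //.
  have -> : 1 + (dc + de) + (\sum_i da i + \sum_i db i) =
      (\sum_i da i + (1 + (\sum_i db i + dc))) + de by ring.
  apply: homogeneous_tens => //.
  have := @l_degree (rcons [seq (db i, b i) | i <- enum 'I_p] (dc, c)).
  rewrite size_rcons map_rcons big_rcons /= sumE => lD.
  have := @mulseq_degree (rcons [seq (da i, a i) | i <- enum 'I_p]
     (1 + (\sum_i db i + dc), l (rcons (map snd [seq (db i, b i) | i <- enum 'I_p]) c))).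
  rewrite map_rcons big_rcons /= sumE; apply=> u; rewrite mem_rcons inE => /orP[/eqP->|]; last first.
    exact: mem.
  apply: lD => // {}u; rewrite mem_rcons inE => /orP[/eqP->//|]; exact: mem.
case: ifP => [|_]; last exact: homogeneous0.
rewrite /args /nilp size_map size_enum_ord => /eqP p0; subst p.
rewrite big_ord0 add0r; apply: ext_degree => //; first exact: bracket_kernel_bimultilinear.
move=> a b da db ha hb; rewrite (args_pairs da a) (args_pairs db b).
have -> : 1 + (\sum_i da i + \sum_i db i) = \sum_i da i + (1 + \sum_i db i) by ring.
apply: homogeneous_tens.
  by rewrite -(sumE _ da a); apply/mulseq_degree/mem.
rewrite -(sumE _ db b); apply: l_degree; first exact: mem.
by rewrite size_map size_enum_ord.
Qed.

End OpMStructure.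

Lemma take_enum_ord n j : (j <= n)%N -> take j (enum 'I_n) =
  filter (fun u : 'I_n => (u < j)%N) (enum 'I_n).
Proof.
move=> jn; apply: (inj_map val_inj); rewrite map_take val_enum_ord take_iota.
rewrite -(filter_map val (fun u => u < j)%N) val_enum_ord.
by rewrite (@filter_iota_ltn 0 n j) // (minn_idPl jn).
Qed.

(** * The two sums of the post-Lie identity as sums over splittings *)

Section SplitForm.
Variables (K : fieldType) (V : gradedType K) (M : seq V -> seq V -> V).
Variables (n m : nat) (x : 'I_n -> V) (y : 'I_m -> V) (dx : 'I_n -> int) (dy : 'I_m -> int).

Lemma first_sum_splits :
  \sum_(0 <= j < n) \sum_(1 <= i < n.+1 | (i + j <= n)%N)
    \sum_(s : 'S_n | shuffle [:: j; i; n - j - i]%N s)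
      (let xs := args (fun u => x (s u)) in
       koszul K dx s *:
         M (M (take j xs) (take i (drop j xs)) :: drop (j + i)%N xs) (args y)) =
  \sum_(p <- splits (enum 'I_n)) \sum_(q <- splits p.2 | (0 < size q.1)%N)
    wsign K dx (p.1 ++ q.1 ++ q.2) *:
      M (M (map x p.1) (map x q.1) :: map x q.2) (map y (enum 'I_m)).
Proof.
pose F j i (w : seq 'I_n) := wsign K dx w *:
  M (M (take j (map x w)) (take i (drop j (map x w))) :: drop (j + i)%N (map x w)) (args y).
pose G (p q : seq 'I_n * seq 'I_n) := wsign K dx (p.1 ++ q.1 ++ q.2) *:
  M (M (map x p.1) (map x q.1) :: map x q.2) (args y).
have szp p : p \in splits (enum 'I_n) -> (size p.1 + size p.2 = n)%N.
  by move=> /splits_perm/perm_size; rewrite size_cat size_enum_ord.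
have szq (w : seq 'I_n) q : q \in splits w -> (size q.1 + size q.2 = size w)%N.
  by move=> /splits_perm/perm_size; rewrite size_cat.
transitivity (\sum_(0 <= j < n) \sum_(p <- splits (enum 'I_n) | size p.1 == j)
    \sum_(q <- splits p.2 | (0 < size q.1)%N) G p q).
  apply: eq_bigr => j _.
  transitivity (\sum_(1 <= i < n.+1) \sum_(p <- splits (enum 'I_n) | size p.1 == j)
    \sum_(q <- splits p.2 | size q.1 == i) G p q).
    rewrite big_mkcond; apply: eq_bigr => i _; case: leqP => ijn.
      transitivity (\sum_(s : 'S_n | shuffle [:: j; i; n - j - i]%N s) F j i (perm_word s)).
        apply: eq_bigr => s _; rewrite /= /F koszul_wsign.
        by rewrite /args /perm_word -!map_comp.
      rewrite big_shuffle3 //; apply: eq_bigr => p /eqP pj; apply: eq_bigr => q /eqP qi.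
      rewrite /F /G !map_cat [(j + i)%N]addnC -drop_drop take_size_cat ?size_map //.
      by rewrite !drop_size_cat ?size_map // take_size_cat ?size_map.
    rewrite big_seq_cond big1 // => p /andP[/szp ps /eqP pj].
    rewrite big_seq_cond big1 // => q /andP[/szq qs /eqP qi]; exfalso.
    have h a b c : (a + b = n)%N -> a = j -> (i + c = b)%N -> False by lia.
    by apply: h ps pj _; rewrite -qi; exact: qs.
  rewrite exchange_big /= big_seq_cond [RHS]big_seq_cond.
  apply: eq_bigr => p /andP[/szp ps _]; rewrite big_fiber_nat big_seq_cond [RHS]big_seq_cond.
  apply: eq_bigl => q; case: (boolP (q \in _)) => //= /szq qs.
  have h a b c e : (a + b = n)%N -> (c + e = b)%N -> (0 < c < n.+1)%N = (0 < c)%N by lia.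
  exact: h ps qs.
(* A first block of size [n] leaves nothing for the nonempty second one; hence stopping at
   [j = n - 1] loses no term. *)
rewrite big_fiber_nat /= big_mkcond big_seq [RHS]big_seq.
apply: eq_bigr => p /szp ps; case: ltnP => // pn.
rewrite big_seq_cond big1 // => q /andP[/szq qs q0]; exfalso.
have h a b c e : (a + b = n)%N -> (c + e = b)%N -> (0 < c)%N -> (n <= a)%N -> False by lia.
exact: h ps qs q0 pn.
Qed.

Lemma second_sum_splits :
  \sum_(0 <= j < n.+1) \sum_(s : 'S_n | shuffle [:: n - j; j]%N s)
    \sum_(1 <= i < m.+1) \sum_(t : 'S_m | shuffle [:: i; m - i]%N t)
      (let xs := args (fun u => x (s u)) in
       let ys := args (fun u => y (t u)) in
       (koszul K dx s * koszul K dy t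
          * (-1) ^ (\sum_(u < n | (u < n - j)%N) dx (s u))) *:
         M (take (n - j)%N xs) (M (drop (n - j)%N xs) (take i ys) :: drop i ys)) =
  \sum_(p <- splits (enum 'I_n)) \sum_(q <- splits (enum 'I_m) | (0 < size q.1)%N)
    (wsign K dx (p.1 ++ p.2) * wsign K dy (q.1 ++ q.2) * (-1) ^ wdeg dx p.1) *:
      M (map x p.1) (M (map x p.2) (map y q.1) :: map y q.2).
Proof.
pose F i j (v : seq 'I_n) (w : seq 'I_m) :=
  (wsign K dx v * wsign K dy w * (-1) ^ wdeg dx (take j v)) *:
  M (take j (map x v)) (M (drop j (map x v)) (take i (map y w)) :: drop i (map y w)).
pose G (p : seq 'I_n * seq 'I_n) (q : seq 'I_m * seq 'I_m) :=
  (wsign K dx (p.1 ++ p.2) * wsign K dy (q.1 ++ q.2) * (-1) ^ wdeg dx p.1) *: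
      M (map x p.1) (M (map x p.2) (map y q.1) :: map y q.2).
have szp k p : p \in splits (enum 'I_k) -> (size p.1 + size p.2 = k)%N.
  by move=> /splits_perm/perm_size; rewrite size_cat size_enum_ord.
(* The identity counts the block of the inner operation, which comes second; after the reversal [j]
   is the size of the first block. *)
rewrite big_nat_rev.
transitivity (\sum_(0 <= j < n.+1) \sum_(p <- splits (enum 'I_n) | size p.1 == j)
    \sum_(q <- splits (enum 'I_m) | (0 < size q.1)%N) G p q).
  apply: eq_big_nat => j /andP[_ jn].
  have -> : (0 + n.+1 - j.+1 = n - j)%N by rewrite add0n subSS.
  rewrite subKn //.
  transitivity (\sum_(s : 'S_n | shuffle [:: j; n - j]%N s)
      \sum_(q <- splits (enum 'I_m) | (0 < size q.1)%N)
      F (size q.1) j (perm_word s) (q.1 ++ q.2)); last first.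
    rewrite (big_shuffle2 (fun v => \sum_(q <- splits (enum 'I_m) | (0 < size q.1)%N)
      F (size q.1) j v (q.1 ++ q.2))) //.
    apply: eq_bigr => p /eqP pj; apply: eq_bigr => q _.
    rewrite /F /G !map_cat !take_size_cat ?size_map // !drop_size_cat ?size_map //.
  apply: eq_bigr => s _.
  transitivity (\sum_(1 <= i < m.+1) \sum_(q <- splits (enum 'I_m) | size q.1 == i)
      F (size q.1) j (perm_word s) (q.1 ++ q.2)).
    apply: eq_big_nat => i /andP[i1 im].
    rewrite [RHS](eq_bigr (fun q => F i j (perm_word s) (q.1 ++ q.2))) => [|q /eqP-> //].
    rewrite -big_shuffle2 //; apply: eq_bigr => t _.
    have -> : \sum_(u < n | (u < j)%N) dx (s u) = wdeg dx (take j (perm_word s)).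
      rewrite /wdeg /perm_word -map_take big_map take_enum_ord // big_filter big_enum_cond /=.
      exact: eq_bigl.
    by rewrite /= /F !koszul_wsign /args /perm_word -!map_comp.
  rewrite big_fiber_nat big_seq_cond [RHS]big_seq_cond; apply: eq_bigl => q.
  case: (boolP (q \in _)) => //= /szp qs.
  have h c e : (c + e = m)%N -> (0 < c < m.+1)%N = (0 < c)%N by lia.
  exact: h qs.
rewrite big_fiber_nat /= big_seq_cond [RHS]big_seq; apply: eq_bigl => p.
case: (boolP (p \in _)) => //= /szp ps.
have h c e : (c + e = n)%N -> (c < n.+1)%N by lia.
exact: h ps.
Qed.

End SplitForm.

Section LinearCombinators.
Variables (K : fieldType) (V U : lmodType K).

Lemma linear_bigsum (T : eqType) (r : seq T) (P : pred T) (f : T -> V -> U) :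
  (forall i, i \in r -> P i -> linear (f i)) -> linear (fun v => \sum_(i <- r | P i) f i v).
Proof.
move=> fl c x y; rewrite scaler_sumr -big_split /= [LHS]big_seq_cond [RHS]big_seq_cond.
by apply: eq_bigr => i /andP[ir Pi]; rewrite fl.
Qed.

Lemma linear_scale_fun k (f : V -> U) : linear f -> linear (fun v => k *: f v).
Proof. by move=> fl c x y; rewrite fl scalerDr !scalerA mulrC. Qed.

Lemma linear_add_fun (f g : V -> U) : linear f -> linear g -> linear (fun v => f v + g v).
Proof. by move=> fl gl c x y; rewrite fl gl scalerDr addrACA. Qed.

End LinearCombinators.

Section LinearAt.
Variables (K : fieldType) (V : gradedType K) (M : seq V -> seq V -> V) (I : eqType).
Hypothesis Ml : forall ys, multilinear (M^~ ys).
Hypothesis Mr : forall xs, multilinear (M xs).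
Variables (z : I -> V) (k : I).
Implicit Types (s t u v : seq I).

Let headl ys (r : seq V) c x y : M ((c *: x + y) :: r) ys = c *: M (x :: r) ys + M (y :: r) ys.
Proof. exact: (Ml ys c x y [::]). Qed.

Let headr xs (r : seq V) c x y : M xs ((c *: x + y) :: r) = c *: M xs (x :: r) + M xs (y :: r).
Proof. exact: (Mr xs c x y [::]). Qed.

(** The index [k] occurs exactly once, so only one of the four blocks varies with [w], and it does
    so in a single entry. *)
Lemma linear_at_left s t u v : uniq (s ++ t ++ u ++ v) -> k \in s ++ t ++ u ++ v ->
  linear (fun w => M (M (map (upd z k w) s) (map (upd z k w) t) :: map (upd z k w) u)
                     (map (upd z k w) v)).
Proof.
move=> un kin; have := count_uniq_mem k un; rewrite kin !count_cat => cnt.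
move: un; rewrite !cat_uniq => /and3P[us _ /and3P[ut _ /and3P[uu _ uv]]].
have no r : count_mem k r = 0%N -> forall w, map (upd z k w) r = map z r.
  by move=> /count_memPn kr w; apply: map_upd_notin.
have pos r : k \in r -> (0 < count_mem k r)%N by rewrite -has_pred1 has_count.
move: kin; rewrite !mem_cat => /or4P[]h; have hp := pos _ h;
  [have [r1 [r2 e]] := map_upd_in z us h | have [r1 [r2 e]] := map_upd_in z ut h |
   have [r1 [r2 e]] := map_upd_in z uu h | have [r1 [r2 e]] := map_upd_in z uv h];
  move=> c x y; rewrite !e ?(no s) ?(no t) ?(no u) ?(no v); try lia.
- by rewrite Ml headl.
- by rewrite Mr headl.
- exact: (Ml _ c x y (_ :: map z r1)).
- exact: Mr.
Qed.

Lemma linear_at_right s t u v : uniq (s ++ t ++ u ++ v) -> k \in s ++ t ++ u ++ v ->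
  linear (fun w => M (map (upd z k w) s)
                     (M (map (upd z k w) t) (map (upd z k w) u) :: map (upd z k w) v)).
Proof.
move=> un kin; have := count_uniq_mem k un; rewrite kin !count_cat => cnt.
move: un; rewrite !cat_uniq => /and3P[us _ /and3P[ut _ /and3P[uu _ uv]]].
have no r : count_mem k r = 0%N -> forall w, map (upd z k w) r = map z r.
  by move=> /count_memPn kr w; apply: map_upd_notin.
have pos r : k \in r -> (0 < count_mem k r)%N by rewrite -has_pred1 has_count.
move: kin; rewrite !mem_cat => /or4P[]h; have hp := pos _ h;
  [have [r1 [r2 e]] := map_upd_in z us h | have [r1 [r2 e]] := map_upd_in z ut h |
   have [r1 [r2 e]] := map_upd_in z uu h | have [r1 [r2 e]] := map_upd_in z uv h];
  move=> c x y; rewrite !e ?(no s) ?(no t) ?(no u) ?(no v); try lia.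
- exact: Ml.
- by rewrite Ml headr.
- by rewrite Mr headr.
- exact: (Mr _ c x y (_ :: map z r1)).
Qed.

End LinearAt.

(** * The alphabet for a family of pure tensors *)

Section Letters.
Variables (K : fieldType) (A : gradedType K) (I : countType).
Variable P : I -> int * int * (A * A).

(** Natural numbers serve as letters, their order being the one that [wsign] sorts by. From 2 on,
    even letters belong to first components and odd ones to second components. *)
Definition letter_degree (c : nat) : int :=
  if c is c'.+2 then
    if unpickle c'./2 is Some k then (if odd c' then (P k).1.2 else (P k).1.1) else 0
  else 1.

(* The letters of the tensor with index [k]; 0 and 1 are the letters of the
   outer and of the inner operation. *)
Definition tensor_letters (k : I) : (seq nat * A) * (seq nat * A) :=
  (([:: (pickle k).*2.+2], (P k).2.1), ([:: (pickle k).*2.+3], (P k).2.2)).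

Lemma wdeg_tensor_letters k :
  wdeg letter_degree (tword (tensor_letters k)) = (P k).1.1 + (P k).1.2.
Proof.
rewrite /wdeg /tword /= big_cons big_seq1 /= odd_double doubleK uphalf_double /=.
by rewrite pickleK.
Qed.

Lemma thomog_tensor_letters k : homogeneous (P k).1.1 (P k).2.1 ->
  homogeneous (P k).1.2 (P k).2.2 -> thomog letter_degree (tensor_letters k).
Proof.
move=> h1 h2; rewrite /thomog /dhomog /wdeg /= !big_seq1 /= odd_double doubleK uphalf_double /=.
by rewrite pickleK h1 h2 !eqxx.
Qed.

Lemma uniq_tensor_letters (ks : seq I) : uniq ks ->
  uniq [:: 0%N, 1%N & twords (map tensor_letters ks)].
Proof.
have letterP c : c \in twords (map tensor_letters ks) ->
    exists2 k, k \in ks & (c == (pickle k).*2.+2) || (c == (pickle k).*2.+3).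
  rewrite /twords -map_comp => /flatten_mapP[k kks]; rewrite /= /tword /= !inE => h.
  by exists k.
move=> uks; rewrite /= !inE /=; apply/and3P; split.
- by apply/negP => /letterP[k _] /orP[] /eqP.
- by apply/negP => /letterP[k _] /orP[] /eqP.
elim: ks uks {letterP} => //= k ks IH /andP[kks /IH u].
rewrite /twords /= in u *; rewrite inE u.
have no c : (c == (pickle k).*2.+2) || (c == (pickle k).*2.+3) ->
    c \notin flatten [seq tword i | i <- map tensor_letters ks].
  move=> hc; apply/negP; rewrite -map_comp => /flatten_mapP[k' k's]; rewrite /= /tword /= !inE => hc'.
  suff e : pickle k = pickle k' by move: kks; rewrite (pcan_inj pickleK e) k's.
  by case/orP: hc hc' => /eqP-> /orP[] /eqP; lia.
rewrite negb_or !no ?eqxx ?orbT // !andbT; apply/eqP; lia.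
Qed.

End Letters.

Section Identity.
Variables (K : fieldType) (A : gradedType K) (mul : A -> A -> A) (l : seq A -> A).
Hypothesis hA : homotopy_Poisson_algebra mul l.
Local Notation V := (tensor A A).
Local Notation M := (opM mul l).
Variables (n m : nat) (dx : 'I_n -> int) (dy : 'I_m -> int).
Hypothesis m0 : (0 < m)%N.
Local Notation I := ('I_n + 'I_m)%type.
Local Notation inX := (map (@inl 'I_n 'I_m)).
Local Notation inY := (map (@inr 'I_n 'I_m)).

Let d (k : I) : int := match k with inl i => dx i | inr j => dy j end.

(** All [n + m] arguments form one family, so that the reduction to pure tensors treats both groups
    at once. *)
Definition opM_sum (z : I -> V) : V :=
  \sum_(p <- splits (enum 'I_n)) \sum_(q <- splits p.2 | (0 < size q.1)%N)
    wsign K dx (p.1 ++ q.1 ++ q.2) *: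
      M (M (map z (inX p.1)) (map z (inX q.1)) :: map z (inX q.2)) (map z (inY (enum 'I_m))) +
  \sum_(p <- splits (enum 'I_n)) \sum_(q <- splits (enum 'I_m) | (0 < size q.1)%N)
    (wsign K dx (p.1 ++ p.2) * wsign K dy (q.1 ++ q.2) * (-1) ^ wdeg dx p.1) *:
      M (map z (inX p.1)) (M (map z (inX p.2)) (map z (inY q.1)) :: map z (inY q.2)).

Lemma enum_sum_uniq p q : perm_eq p (enum 'I_n) -> perm_eq q (enum 'I_m) ->
  uniq (inX p ++ inY q).
Proof.
move=> pp pq; rewrite cat_uniq !map_inj_uniq ?(perm_uniq pp) ?(perm_uniq pq) ?enum_uniq /=;
  try by move=> ? ? [].
by rewrite andbT; apply/hasPn => _ /mapP[j _ ->]; apply/mapP => -[].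
Qed.

Lemma enum_sum_mem (k : I) p q : perm_eq p (enum 'I_n) -> perm_eq q (enum 'I_m) ->
  k \in inX p ++ inY q.
Proof.
move=> pp pq; rewrite mem_cat.
by case: k => [i|j]; apply/orP; [left | right]; apply: map_f;
  rewrite ?(perm_mem pp) ?(perm_mem pq) mem_enum.
Qed.

Lemma opM_sum_linear z k : linear (fun w => opM_sum (upd z k w)).
Proof.
apply: linear_add_fun; apply: linear_bigsum => p ps _; apply: linear_bigsum => q qs _;
    apply: linear_scale_fun.
  have pe : perm_eq (p.1 ++ q.1 ++ q.2) (enum 'I_n).
    by rewrite (perm_trans _ (splits_perm ps)) // perm_cat2l splits_perm.
  have u := enum_sum_uniq pe (perm_refl (enum 'I_m)).
  have kin := enum_sum_mem k pe (perm_refl (enum 'I_m)).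
  rewrite !map_cat -!catA in u kin.
  by apply: linear_at_left => //; [apply: opM_multilinearl | apply: opM_multilinearr].
have u := enum_sum_uniq (splits_perm ps) (splits_perm qs).
have kin := enum_sum_mem k (splits_perm ps) (splits_perm qs).
rewrite !map_cat -!catA in u kin.
by apply: linear_at_right => //; [apply: opM_multilinearl | apply: opM_multilinearr].
Qed.

Lemma opM_sum_pure z : (forall k, pure_homogeneous (d k) (z k)) -> opM_sum z = 0.
Proof.
move=> /choice[P hP]; pose D := letter_degree P; pose delta := tensor_letters P.
have zE (ks : seq I) : map z ks = map (@tens_val _ _ K A) (map delta ks).
  by rewrite -map_comp; apply: eq_map => k; have [_ _ _ ->] := hP k.
pose X := map delta (inX (enum 'I_n)); pose Y := map delta (inY (enum 'I_m)).
have hd (ks : seq I) : all (thomog D) (map delta ks).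
  by apply/allP => _ /mapP[k _ ->]; have [_ h1 h2 _] := hP k; apply: thomog_tensor_letters.
(* The sign of the word in its original order. It is nonzero, so it suffices to prove the identity
   multiplied by it. *)
pose W := wsign K D (0%N :: 1%N :: twords X ++ twords Y).
have W0 : W != 0.
  rewrite /W wsign_uniq /X /Y /twords -flatten_cat -!map_cat; apply: uniq_tensor_letters.
  exact: enum_sum_uniq.
apply/eqP; rewrite -[_ == 0]orFb -(negbTE W0) -scaler_eq0; apply/eqP.
have Y0 : (0 < size Y)%N by rewrite size_map size_map size_enum_ord.
have := opM_words hA (erefl : D 0%N = 1) (erefl : D 1%N = 1) (hd _ : all _ X) (hd _ : all _ Y) Y0.
(* Putting one group of arguments back into its original order costs the Koszul sign of the
   shuffle. *)
have sgn k (e : 'I_k -> int) (inj : 'I_k -> I) w w1 w2 : perm_eq w (enum 'I_k) ->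
    (forall i, d (inj i) = e i) ->
    wsign K D (w1 ++ twords (map delta (map inj w)) ++ w2) =
    wsign K e w * wsign K D (w1 ++ twords (map delta (map inj (enum 'I_k))) ++ w2).
  have tE (s : seq 'I_k) : twords (map delta (map inj s)) =
      flatten (map (fun i => tword (delta (inj i))) s) by rewrite /twords -!map_comp.
  move=> pw de; rewrite !tE.
  have he i : wdeg D (tword (delta (inj i))) = e i.
    by rewrite wdeg_tensor_letters -de; have [-> _ _ _] := hP (inj i).
  have := wsign_subst K w1 w2 he pw; rewrite (wsign_sorted _ _ (sorted_enum_ord k)) mul1r => <-.
  by rewrite mulrA wsign_sq ?mul1r // (perm_uniq pw) enum_uniq.
have twc (s t : seq ((seq nat * A) * (seq nat * A))) : twords (s ++ t) = twords s ++ twords t.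
  by rewrite /twords map_cat flatten_cat.
have wdX w : wdeg D (twords (map delta (inX w))) = wdeg dx w.
  rewrite /wdeg /twords big_flatten !big_map; apply: eq_bigr => i _.
  have [e _ _ _] := hP (inl i); rewrite -[RHS]e; exact: (wdeg_tensor_letters P (inl i)).
move=> H; rewrite -[RHS]H {H} /opM_sum scalerDr !scaler_sumr; congr (_ + _).
  rewrite {1}/X (splits_map delta) (splits_map (@inl 'I_n 'I_m)) 2!big_map [LHS]big_seq [RHS]big_seq; apply: eq_bigr => p ps.
  rewrite scaler_sumr /= (splits_map delta) (splits_map (@inl 'I_n 'I_m)) 2!big_map [LHS]big_seq_cond [RHS]big_seq_cond.
  apply: eq_big => [q|q /andP[qs q0]]; first by rewrite !size_map.
  have pe : perm_eq (p.1 ++ q.1 ++ q.2) (enum 'I_n).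
    by apply: perm_trans (splits_perm ps); rewrite perm_cat2l splits_perm.
  rewrite !zE scalerA; congr (_ *: _).
  have := sgn n dx inl _ [:: 0%N; 1%N] (twords Y) pe (fun=> erefl).
  by rewrite !map_cat !twc -!catA /= => ->; rewrite mulrC.
rewrite (splits_map delta) (splits_map (@inl 'I_n 'I_m)) 2!big_map [LHS]big_seq [RHS]big_seq; apply: eq_bigr => p ps.
rewrite scaler_sumr /= (splits_map delta) (splits_map (@inr 'I_n 'I_m)) 2!big_map [LHS]big_seq_cond [RHS]big_seq_cond.
apply: eq_big => [q|q /andP[qs q0]]; first by rewrite !size_map.
rewrite !zE scalerA; congr (_ *: _).
(* The explicit sign in the second sum arises here: the letter of the inner operation passes the
   arguments in [p.1]. *)
have e := wsign_swap K D [:: 0%N] (twords (map delta (inX p.1))) [:: 1%N]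
  (twords (map delta (inX p.2)) ++ twords (map delta (inY q.1)) ++ twords (map delta (inY q.2))).
have wd1 : wdeg D [:: 1%N] = 1 by rewrite /wdeg big_seq1.
rewrite [RHS]e wdX wd1 mulr1 {e wd1}.
have := sgn n dx inl _ [:: 0%N; 1%N] (twords (map delta (inY (q.1 ++ q.2)))) (splits_perm ps)
  (fun=> erefl).
have := sgn m dy inr _ (0%N :: 1%N :: twords X) [::] (splits_perm qs) (fun=> erefl).
rewrite !cats0 !map_cat !twc -!catA /= => e1 e2; rewrite e2 e1 /W; ring.
Qed.

Lemma opM_identity (x : 'I_n -> V) (y : 'I_m -> V) :
  (forall i, homogeneous (dx i) (x i)) -> (forall i, homogeneous (dy i) (y i)) ->
  \sum_(p <- splits (enum 'I_n)) \sum_(q <- splits p.2 | (0 < size q.1)%N)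
    wsign K dx (p.1 ++ q.1 ++ q.2) *:
      M (M (map x p.1) (map x q.1) :: map x q.2) (map y (enum 'I_m)) +
  \sum_(p <- splits (enum 'I_n)) \sum_(q <- splits (enum 'I_m) | (0 < size q.1)%N)
    (wsign K dx (p.1 ++ p.2) * wsign K dy (q.1 ++ q.2) * (-1) ^ wdeg dx p.1) *:
      M (map x p.1) (M (map x p.2) (map y q.1) :: map y q.2) = 0.
Proof.
move=> hx hy; pose z (k : I) := match k with inl i => x i | inr j => y j end.
have H := @pure_homogeneous_ind _ _ _ d _ opM_sum opM_sum_linear opM_sum_pure z.
have zX w : map z (inX w) = map x w by rewrite -map_comp.
have zY w : map z (inY w) = map y w by rewrite -map_comp.
rewrite -[RHS]H; last by case=> [i|j]; [apply: hx | apply: hy].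
by congr (_ + _); apply: eq_bigr => p _; apply: eq_bigr => q _; rewrite !zX !zY.
Qed.

End Identity.

Theorem corollary4p17 (K : fieldType) (charK0 : [pchar K] =i pred0)
    (A : gradedType K) (mul : A -> A -> A) (l : seq A -> A)
    (hA : homotopy_Poisson_algebra mul l) :
  exists M : seq (tensor A A) -> seq (tensor A A) -> tensor A A,
    [/\ post_Lie_infty_algebra M,
        (* M_{0,1} *)
        forall (e : int) (a x : A), homogeneous e a ->
          M [::] [:: a ⊗ x] = l [:: a] ⊗ x + (-1) ^ e *: (a ⊗ l [:: x]),
        (* M_{0,q}, q >= 2 *)
        forall (q : nat) (a x : 'I_q -> A) (da dx : 'I_q -> int), (2 <= q)%N ->
          (forall i, homogeneous (da i) (a i)) -> (forall i, homogeneous (dx i) (x i)) ->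
          M [::] (args (fun i => a i ⊗ x i)) =
            (-1) ^ tens_sign_exp da dx *: (mulseq mul (args a) ⊗ l (args x)),
        (* M_{p,1}, p >= 1 *)
        forall (p : nat) (a x : 'I_p -> A) (da dx : 'I_p -> int) (a' x' : A), (1 <= p)%N ->
          (forall i, homogeneous (da i) (a i)) -> (forall i, homogeneous (dx i) (x i)) ->
          M (args (fun i => a i ⊗ x i)) [:: a' ⊗ x'] =
            (-1) ^ tens_sign_exp da dx *:
              (mulseq mul (rcons (args a) (l (rcons (args x) a'))) ⊗ x') &
        (* M_{p,q} for p >= 1 and q >= 2 *)
        forall xs ys : seq (tensor A A),
          (1 <= size xs)%N -> (2 <= size ys)%N -> M xs ys = 0].
Proof.
exists (opM mul l); split.
- split.
  + by move=> ys _; apply: opM_multilinearl.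
  + exact: opM_multilinearr.
  + by move=> ys _; apply: opM_symmetricl.
  + exact: opM_symmetricr.
  + exact: opM_degree.
  + move=> n m x y dx dy m0 hx hy; rewrite first_sum_splits second_sum_splits.
    exact: opM_identity.
- move=> e a x ha; have lK := bracket_kernel_bimultilinear hA.
  rewrite /opM /= /lie_action /lie_bracket {1}/ext (action_kernel_tens hA); congr (_ + _).
  (* Here [x] need not be homogeneous, while [ext_tens_cons] requires it, so both sides are compared
     on the components of [x]. *)
  have xl : linear (fun x => ext [:: a ⊗ x] (bracket_kernel mul l) 1).
    by move=> c u v; rewrite tens_linearr (ext_cons_linear [::] 1 lK).
  rewrite [in LHS](gsupp_sum x) (lin_sum xl) [in RHS](gsupp_sum x).
  have rl : linear (fun x => (-1) ^ e *: (a ⊗ l [:: x])).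
    move=> c u v; have := Linfty_multilinear (hPoisson_Linfty hA) c u v [::] [::].
    by move=> /= ->; rewrite tens_linearr scalerDr !scalerA [c * _]mulrC.
  rewrite (lin_sum rl); apply: eq_bigr => i _.
  by rewrite (ext_tens_cons _ _ lK ha (homogeneous_hcomp i x)) mul1r.
- move=> q a x da dx q2 ha hx; rewrite /opM /= size_map size_enum_ord.
  rewrite ifN ?add0r; last by case: q q2 {a x da dx ha hx} => [|[]].
  (* With initial exponent 1, the degree of the operation, the sign of [ext_args] is
     [tens_sign_exp]. *)
  exact: (ext_args 1 (bracket_kernel_bimultilinear hA) ha hx).
- move=> p a x da dx a' x' p1 ha hx; rewrite /opM /= /nilp size_map size_enum_ord.
  rewrite (gtn_eqF p1) addr0.
  rewrite [LHS](ext_args 1 (action_kernel_bimultilinear hA _) ha hx).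
  by rewrite (action_kernel_tens hA).
move=> xs ys x1 y2; rewrite /opM /nilp (gtn_eqF x1) (gtn_eqF y2) addr0 //.
Qed.
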